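(* Let $(E,C)$ be a separated graph, $K$ a commutative unital ring with involution, and $\mathfrak E\colon C^{\mathrm{fin}}\to E^1$ a choice function. A $K$-linear basis of the tame Leavitt path algebra $\mathcal L_K^{\mathrm{ab}}(E,C)$ is given by the elements $$\overline{\mathcal B}(E,C)=\{\mathbf e(T)\rtimes g : g\in\mathbb F_C,\ T\in D_g^L\text{ and } T \text{ is } \mathfrak E\text{-reduced relatively to } g_L\}.$$
   Context: Graphs and paths. A directed graph $E=(E^0,E^1,s,r)$ has arbitrary sets of vertices and edges and source/range maps $s,r$. A separated graph $(E,C)$ is a directed graph with $C=\bigsqcup_{v\in E^0}C_v$, where $C_v$ is a partition of $s^{-1}(v)$ into pairwise disjoint nonempty subsets ($C_v=\emptyset$ if $s^{-1}(v)=\emptyset$). $C^{\mathrm{fin}}=\{X\in C:|X|<\infty\}$. For $e\in E^1$ let $e^{-1}$ be a formal inverse with $s(e^{-1})=r(e)$, $r(e^{-1})=s(e)$; $E^{-1}=\{e^{-1}\}$, $\hat E^1=E^1\cup E^{-1}$. A path is a vertex or a sequence $y_1\cdots y_n$ in $\hat E^1$ with $r(y_i)=s(y_{i+1})$; it is reduced if it has no subpath $xx^{-1}$, $x\in\hat E^1$. $\alpha\cdot\beta$ denotes the reduction of the concatenation $\alpha\beta$ when $r(\alpha)=s(\beta)$. A lower subset is a set of reduced paths closed under taking prefixes (the vertex $s(\nu)$ is a prefix of $\nu$); $\max(T)$ is the set of prefix-maximal elements of $T$. $C$-compatible trees. A $C$-separated path is a reduced path with no subpath $x^{-1}y$ with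 $x,y\in X$, $X\in C$. $\mathbb F_C(v)$ is the set of $C$-separated paths with source $v$; $\mathbb F_C=\bigsqcup_v\mathbb F_C(v)$. $\gamma,\nu\in\mathbb F_C(v)$ are $C$-compatible if $\nu^{-1}\cdot\gamma\in\mathbb F_C$; a set is $C$-compatible if its elements are pairwise so. $\mathcal X(v)$ is the set of nonempty finite lower $C$-compatible subsets of $\mathbb F_C(v)$. $\mathcal X_L(v)$ is the set of $T\in\mathcal X(v)$ such that no maximal element of $T$ ends in an element of $E^{-1}$ or in an edge $e$ with $\{e\}\in C$. Each reduced path $g$ is uniquely $g=g_Lw$, where $g_L$ is $s(g)$ or a prefix of $g$ ending in an edge $e\in X\in C$ with $|X|>1$, and $w$ is a (possibly empty) product of elements of $E^{-1}$ and edges $x$ with $\{x\}\in C$. For $g\in\mathbb F_C(v)$, $D_g^L=\{T\in\mathcal X_L(v):g_L\in T\}$ (so $D_v^L=\mathcal X_L(v)$). Reducedness. A choice function is a map $\mathfrak E\colon C^{\mathrm{fin}}\to E^1$ with $\mathfrak E(X)\in X$ for all $X$. A path $\lambda\in\mathbb F_C$ is $\mathfrak E$-reduced if it does not end with $\mathfrak E(X)$ for any $X\in C^{\mathrm{fin}}$. $T\in D_g^L$ is $\mathfrak E$-reduced relatively to $g_L$ if each element of $\max(T)\setminus\{g_L\}$ is $\mathfrak E$-reduced. Algebras. The Leavitt path algebra $\mathcal L_K(E,C)$ is the universal $*$-algebra over $K$ generated by self-adjoint elements $v\in E^0$ and elements $e\in E^1$ subject to: $vw=\delta_{v,w}v$;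 $s(e)e=e=er(e)$; $e^*s(e)=e^*=r(e)e^*$; $e^*f=\delta_{e,f}r(e)$ for $e,f\in X$, $X\in C$; and $\sum_{e\in X}ee^*=v$ for every $X\in C_v$ finite, $v\in E^0$. The tame algebra $\mathcal L_K^{\mathrm{ab}}(E,C)$ is its quotient by the two-sided ideal generated by all commutators $[xx^*,yy^*]$, with $x,y$ in the multiplicative $*$-subsemigroup generated by $E^0\cup E^1$. A path $g=y_1\cdots y_n$ is viewed as an element of the algebra by taking the product, with $e^{-1}$ interpreted as $e^*$. For $T\in\mathcal X(v)$, $\mathbf e(T)=\prod_{\lambda\in\max(T)}\lambda\lambda^*$, and $\mathbf e(T)\rtimes g$ denotes the element $\mathbf e(T)\,g$. *)

(* Defs.v *)
From HB Require Import structures.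
From mathcomp Require Import all_boot all_order all_algebra finmap.
From mathcomp Require Import boolp classical_sets functions cardinality fsbigop.

Set Implicit Arguments.
Unset Strict Implicit.
Unset Printing Implicit Defensive.
Import GRing.Theory.

Local Open Scope classical_set_scope.
Local Open Scope ring_scope.

(* No unit is required: E^0 may be infinite. *)
Record starAlg (K : comPzRingType) (cj : K -> K) := StarAlg {
  sa_sort :> lmodType K;
  sa_mul : sa_sort -> sa_sort -> sa_sort;
  sa_star : sa_sort -> sa_sort;
  sa_mulA : associative sa_mul;
  sa_mulDl : left_distributive sa_mul +%R;
  sa_mulDr : right_distributive sa_mul +%R;
  sa_mulZl : forall (k : K) (x y : sa_sort),
    sa_mul (k *: x) y = k *: sa_mul x y;
  sa_mulZr : forall (k : K) (x y : sa_sort),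
    sa_mul x (k *: y) = k *: sa_mul x y;
  sa_starK : involutive sa_star;
  sa_starD : {morph sa_star : x y / x + y};
  sa_starZ : forall (k : K) (x : sa_sort),
    sa_star (k *: x) = cj k *: sa_star x;
  sa_starM : forall x y : sa_sort,
    sa_star (sa_mul x y) = sa_mul (sa_star y) (sa_star x) }.

Arguments sa_mul {K cj s} x y.
Arguments sa_star {K cj s} x.

Reserved Notation "x ** y" (at level 40, left associativity).
Notation "x ** y" := (sa_mul x y) : ring_scope.
Notation "x ^!" := (sa_star x) : ring_scope.

(* The value at [::] is junk: A need not have a unit. *)
Definition sa_prod (K : comPzRingType) (cj : K -> K) (A : starAlg cj)
    (s : seq A) : A :=
  if s is x :: s' then foldl sa_mul x s' else 0.

Definition is_star_hom (K : comPzRingType) (cj : K -> K) (A B : starAlg cj)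
    (f : A -> B) : Prop :=
  [/\ {morph f : x y / x + y}, forall k x, f (k *: x) = k *: f x,
      {morph f : x y / x ** y} & {morph f : x / x^!}].

Section StarAlgTheory.
Variables (K : comPzRingType) (cj : K -> K).

Lemma sa_mul0l (A : starAlg cj) (x : A) : 0 ** x = 0.
Proof. by rewrite -(scale0r 0) sa_mulZl !scale0r. Qed.

Lemma sa_mul0r (A : starAlg cj) (x : A) : x ** 0 = 0.
Proof. by rewrite -(scale0r 0) sa_mulZr !scale0r. Qed.

Lemma sa_mulNl (A : starAlg cj) (x y : A) : (- x) ** y = - (x ** y).
Proof. by rewrite -scaleN1r sa_mulZl scaleN1r. Qed.

Lemma sa_mulNr (A : starAlg cj) (x y : A) : x ** (- y) = - (x ** y).
Proof. by rewrite -scaleN1r sa_mulZr scaleN1r. Qed.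

Lemma sa_star0 (A : starAlg cj) : (0 : A)^! = 0.
Proof. by apply: (@addrI _ (0 : A)^!); rewrite -sa_starD !addr0. Qed.

Lemma sa_starN (A : starAlg cj) (x : A) : (- x)^! = - x^!.
Proof. by apply: (@addrI _ x^!); rewrite -sa_starD !subrr sa_star0. Qed.

End StarAlgTheory.

Section FreeStarAlgebra.
Variables (K : comPzRingType) (cj : K -> K) (G : Type).

Inductive term :=
| TGen of G
| TZero
| TAdd of term & term
| TScale of K & term
| TMul of term & term
| TStar of term.

HB.instance Definition _ := gen_eqMixin term.
HB.instance Definition _ := gen_choiceMixin term.

Inductive teq : term -> term -> Prop :=
| teq_refl t : teq t t
| teq_sym t u : teq t u -> teq u t
| teq_trans t u w : teq t u -> teq u w -> teq t w
| teq_add t t' u u' : teq t t' -> teq u u' -> teq (TAdd t u) (TAdd t' u')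
| teq_scale k t t' : teq t t' -> teq (TScale k t) (TScale k t')
| teq_mul t t' u u' : teq t t' -> teq u u' -> teq (TMul t u) (TMul t' u')
| teq_star t t' : teq t t' -> teq (TStar t) (TStar t')
| teq_addA t u w : teq (TAdd t (TAdd u w)) (TAdd (TAdd t u) w)
| teq_addC t u : teq (TAdd t u) (TAdd u t)
| teq_add0 t : teq (TAdd TZero t) t
| teq_addN t : teq (TAdd (TScale (-1) t) t) TZero
| teq_scaleA k l t : teq (TScale k (TScale l t)) (TScale (k * l) t)
| teq_scale1 t : teq (TScale 1 t) t
| teq_scaleDr k t u : teq (TScale k (TAdd t u)) (TAdd (TScale k t) (TScale k u))
| teq_scaleDl k l t : teq (TScale (k + l) t) (TAdd (TScale k t) (TScale l t))
| teq_mulA t u w : teq (TMul t (TMul u w)) (TMul (TMul t u) w)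
| teq_mulDl t u w : teq (TMul (TAdd t u) w) (TAdd (TMul t w) (TMul u w))
| teq_mulDr t u w : teq (TMul t (TAdd u w)) (TAdd (TMul t u) (TMul t w))
| teq_mulZl k t u : teq (TMul (TScale k t) u) (TScale k (TMul t u))
| teq_mulZr k t u : teq (TMul t (TScale k u)) (TScale k (TMul t u))
| teq_starK t : teq (TStar (TStar t)) t
| teq_starD t u : teq (TStar (TAdd t u)) (TAdd (TStar t) (TStar u))
| teq_starZ k t : teq (TStar (TScale k t)) (TScale (cj k) (TStar t))
| teq_starM t u : teq (TStar (TMul t u)) (TMul (TStar u) (TStar t)).

Definition teqb (t u : term) : bool := `[< teq t u >].

Lemma teqb_equiv : equiv_class_of teqb.
Proof.
split=> [t|t u|u t w]; rewrite /teqb.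
- by apply/asboolP; apply: teq_refl.
- by apply: asbool_equiv_eq; split; apply: teq_sym.
- by move=> /asboolP h /asboolP h'; apply/asboolP; apply: teq_trans h h'.
Qed.

Canonical teqb_equivRel := EquivRelPack teqb_equiv.
Canonical teqb_encModRel := defaultEncModRel teqb.

Definition freeT := {eq_quot teqb}%qT.
HB.instance Definition _ := Choice.on freeT.

Local Notation cls := (\pi_freeT%qT : term -> freeT).

Lemma freeP t u : (cls t = cls u) <-> teq t u.
Proof.
split=> [/eqP|h]; first by rewrite eqmodE => /asboolP.
by apply/eqP; rewrite eqmodE; apply/asboolP.
Qed.

Let rep (x : freeT) : term := repr x.

Let repK x : cls (rep x) = x. Proof. exact: reprK. Qed.

Let teq_rep t : teq (rep (cls t)) t.
Proof. by apply/freeP; rewrite repK. Qed.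

Let f_add (x y : freeT) : freeT := cls (TAdd (rep x) (rep y)).
Let f_scale k (x : freeT) : freeT := cls (TScale k (rep x)).
Let f_opp (x : freeT) : freeT := f_scale (-1) x.
Let f_mul (x y : freeT) : freeT := cls (TMul (rep x) (rep y)).
Let f_star (x : freeT) : freeT := cls (TStar (rep x)).

Let f_addE t u : f_add (cls t) (cls u) = cls (TAdd t u).
Proof. by apply/freeP; apply: teq_add; apply: teq_rep. Qed.
Let f_scaleE k t : f_scale k (cls t) = cls (TScale k t).
Proof. by apply/freeP; apply: teq_scale; apply: teq_rep. Qed.
Let f_mulE t u : f_mul (cls t) (cls u) = cls (TMul t u).
Proof. by apply/freeP; apply: teq_mul; apply: teq_rep. Qed.
Let f_starE t : f_star (cls t) = cls (TStar t).
Proof. by apply/freeP; apply: teq_star; apply: teq_rep. Qed.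

Let free_ind (P : freeT -> Prop) : (forall t, P (cls t)) -> forall x, P x.
Proof. by move=> h x; rewrite -(repK x). Qed.

Let f_addA : associative f_add.
Proof.
elim/free_ind=> t; elim/free_ind=> u; elim/free_ind=> w.
by rewrite !f_addE; apply/freeP; apply: teq_addA.
Qed.
Let f_addC : commutative f_add.
Proof.
elim/free_ind=> t; elim/free_ind=> u.
by rewrite !f_addE; apply/freeP; apply: teq_addC.
Qed.
Let f_add0 : left_id (cls TZero) f_add.
Proof. by elim/free_ind=> t; rewrite f_addE; apply/freeP; apply: teq_add0. Qed.
Let f_addN : left_inverse (cls TZero) f_opp f_add.
Proof.
by elim/free_ind=> t; rewrite /f_opp f_scaleE f_addE; apply/freeP;
  apply: teq_addN.
Qed.

HB.instance Definition _ :=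
  GRing.isZmodule.Build freeT f_addA f_addC f_add0 f_addN.

Let f_scaleA k l x : f_scale k (f_scale l x) = f_scale (k * l) x.
Proof.
by elim/free_ind: x => t; rewrite !f_scaleE; apply/freeP; apply: teq_scaleA.
Qed.
Let f_scale1 : left_id 1 f_scale.
Proof.
by elim/free_ind=> t; rewrite f_scaleE; apply/freeP; apply: teq_scale1.
Qed.
Let f_scaleDr : right_distributive f_scale +%R.
Proof.
move=> k; elim/free_ind=> t; elim/free_ind=> u.
change (f_scale k (f_add (cls t) (cls u)) =
        f_add (f_scale k (cls t)) (f_scale k (cls u))).
by rewrite f_addE !f_scaleE f_addE; apply/freeP; apply: teq_scaleDr.
Qed.
Let f_scaleDl x : {morph f_scale^~ x : k l / k + l}.
Proof.
move=> k l; elim/free_ind: x => t.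
change (f_scale (k + l) (cls t) =
        f_add (f_scale k (cls t)) (f_scale l (cls t))).
by rewrite !f_scaleE f_addE; apply/freeP; apply: teq_scaleDl.
Qed.

HB.instance Definition _ :=
  GRing.Zmodule_isLmodule.Build K freeT f_scaleA f_scale1 f_scaleDr f_scaleDl.

Let f_mulA : associative f_mul.
Proof.
elim/free_ind=> t; elim/free_ind=> u; elim/free_ind=> w.
by rewrite !f_mulE; apply/freeP; apply: teq_mulA.
Qed.
Let f_mulDl : left_distributive f_mul +%R.
Proof.
elim/free_ind=> t; elim/free_ind=> u; elim/free_ind=> w.
change (f_mul (f_add (cls t) (cls u)) (cls w) =
        f_add (f_mul (cls t) (cls w)) (f_mul (cls u) (cls w))).
by rewrite f_addE !f_mulE f_addE; apply/freeP; apply: teq_mulDl.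
Qed.
Let f_mulDr : right_distributive f_mul +%R.
Proof.
elim/free_ind=> t; elim/free_ind=> u; elim/free_ind=> w.
change (f_mul (cls t) (f_add (cls u) (cls w)) =
        f_add (f_mul (cls t) (cls u)) (f_mul (cls t) (cls w))).
by rewrite f_addE !f_mulE f_addE; apply/freeP; apply: teq_mulDr.
Qed.
Let f_mulZl k (x y : freeT) : f_mul (k *: x) y = k *: f_mul x y.
Proof.
elim/free_ind: x => t; elim/free_ind: y => u.
change (f_mul (f_scale k (cls t)) (cls u) = f_scale k (f_mul (cls t) (cls u))).
by rewrite f_scaleE !f_mulE f_scaleE; apply/freeP; apply: teq_mulZl.
Qed.
Let f_mulZr k (x y : freeT) : f_mul x (k *: y) = k *: f_mul x y.
Proof.
elim/free_ind: x => t; elim/free_ind: y => u.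
change (f_mul (cls t) (f_scale k (cls u)) = f_scale k (f_mul (cls t) (cls u))).
by rewrite f_scaleE !f_mulE f_scaleE; apply/freeP; apply: teq_mulZr.
Qed.
Let f_starK : involutive f_star.
Proof. by elim/free_ind=> t; rewrite !f_starE; apply/freeP; apply: teq_starK. Qed.
Let f_starD : {morph f_star : x y / x + y}.
Proof.
elim/free_ind=> t; elim/free_ind=> u.
change (f_star (f_add (cls t) (cls u)) =
        f_add (f_star (cls t)) (f_star (cls u))).
by rewrite f_addE !f_starE f_addE; apply/freeP; apply: teq_starD.
Qed.
Let f_starZ k (x : freeT) : f_star (k *: x) = cj k *: f_star x.
Proof.
elim/free_ind: x => t.
change (f_star (f_scale k (cls t)) = f_scale (cj k) (f_star (cls t))).
by rewrite f_scaleE !f_starE f_scaleE; apply/freeP; apply: teq_starZ.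
Qed.
Let f_starM x y : f_star (f_mul x y) = f_mul (f_star y) (f_star x).
Proof.
elim/free_ind: x => t; elim/free_ind: y => u.
by rewrite f_mulE !f_starE f_mulE; apply/freeP; apply: teq_starM.
Qed.

Definition freeAlg : starAlg cj :=
  StarAlg f_mulA f_mulDl f_mulDr f_mulZl f_mulZr f_starK f_starD f_starZ f_starM.

Definition fgen (g : G) : freeAlg := cls (TGen g).

Section Universal.
Variables (A : starAlg cj) (h : G -> A).

Fixpoint teval (t : term) : A :=
  match t with
  | TGen g => h g
  | TZero => 0
  | TAdd t u => teval t + teval u
  | TScale k t => k *: teval t
  | TMul t u => teval t ** teval u
  | TStar t => (teval t)^!
  end.

Lemma teval_teq t u : teq t u -> teval t = teval u.
Proof.
elim=> //=; try by move=> *; congruence.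
- by move=> *; rewrite addrA.
- by move=> *; rewrite addrC.
- by move=> *; rewrite add0r.
- by move=> *; rewrite scaleN1r addNr.
- by move=> *; rewrite scalerA.
- by move=> *; rewrite scale1r.
- by move=> *; rewrite scalerDr.
- by move=> *; rewrite scalerDl.
- by move=> *; rewrite sa_mulA.
- by move=> *; rewrite sa_mulDl.
- by move=> *; rewrite sa_mulDr.
- by move=> *; rewrite sa_mulZl.
- by move=> *; rewrite sa_mulZr.
- by move=> *; rewrite sa_starK.
- by move=> *; rewrite sa_starD.
- by move=> *; rewrite sa_starZ.
- by move=> *; rewrite sa_starM.
Qed.

Definition free_lift (x : freeAlg) : A := teval (repr (x : freeT)).

Let free_liftE t : free_lift (cls t) = teval t.
Proof. by apply: teval_teq; apply: teq_rep. Qed.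

Lemma free_lift_gen g : free_lift (fgen g) = h g.
Proof. exact: free_liftE. Qed.

Lemma free_lift_hom : is_star_hom free_lift.
Proof.
split.
- elim/free_ind=> t; elim/free_ind=> u.
  by rewrite [cls t + _]f_addE !free_liftE.
- by move=> k; elim/free_ind=> t; rewrite [k *: _]f_scaleE !free_liftE.
- elim/free_ind=> t; elim/free_ind=> u.
  by rewrite [_ ** _]f_mulE !free_liftE.
- by elim/free_ind=> t; rewrite [_^!]f_starE !free_liftE.
Qed.

Lemma free_lift_uniq (f : freeAlg -> A) :
  is_star_hom f -> (forall g, f (fgen g) = h g) -> f =1 free_lift.
Proof.
move=> [fD fZ fM fS] fg; elim/free_ind=> t; rewrite free_liftE.
have f0 : f 0 = 0 by apply: (@addrI _ (f 0)); rewrite -fD !addr0.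
elim: t => [g||t IHt u IHu|k t IHt|t IHt u IHu|t IHt] /=.
- exact: fg.
- exact: f0.
- by rewrite -IHt -IHu -fD -f_addE.
- by rewrite -IHt -fZ -f_scaleE.
- by rewrite -IHt -IHu -fM -f_mulE.
- by rewrite -IHt -fS -f_starE.
Qed.

End Universal.
End FreeStarAlgebra.

Arguments fgen {K cj G} g.

Section IdealQuotient.
Variables (K : comPzRingType) (cj : K -> K) (A : starAlg cj) (S : set A).

Inductive ideal : A -> Prop :=
| ideal_gen x : S x -> ideal x
| ideal0 : ideal 0
| idealD x y : ideal x -> ideal y -> ideal (x + y)
| idealZ k x : ideal x -> ideal (k *: x)
| idealMl a x : ideal x -> ideal (a ** x)
| idealMr a x : ideal x -> ideal (x ** a).

Definition idealb : {pred A} := fun x => `[< ideal x >].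

Lemma idealb_zmod_closed : zmod_closed idealb.
Proof.
split=> [|x y]; first by apply/asboolP; apply: ideal0.
move=> /asboolP hx /asboolP hy; apply/asboolP; apply: idealD => //.
by rewrite -scaleN1r; apply: idealZ.
Qed.

HB.instance Definition _ := GRing.isZmodClosed.Build A idealb idealb_zmod_closed.

Definition quotT := Quotient.quot idealb.
HB.instance Definition _ := GRing.Zmodule.on quotT.

Definition qproj (x : A) : quotT := (\pi_quotT x)%qT.

Lemma qprojP x y : qproj x = qproj y <-> ideal (x - y).
Proof.
split=> [/eqP|h]; first by rewrite -Quotient.idealrBE => /asboolP.
by apply/eqP; rewrite -Quotient.idealrBE; apply/asboolP.
Qed.

Lemma qproj_eq0 x : qproj x = 0 <-> ideal x.
Proof.
rewrite -[x in ideal x]subr0 -qprojP.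
suff -> : qproj 0 = 0 by [].
exact: (raddf0 (\pi_(Quotient.quot idealb))%qT).
Qed.

Lemma qprojD : {morph qproj : x y / x + y}.
Proof. exact: (raddfD (\pi_(Quotient.quot idealb))%qT). Qed.

Let rep (x : quotT) : A := repr x.
Let repK x : qproj (rep x) = x. Proof. exact: reprK. Qed.
Let rep_ideal x : ideal (rep (qproj x) - x).
Proof. by apply/qprojP; rewrite repK. Qed.
Let q_ind (P : quotT -> Prop) : (forall t, P (qproj t)) -> forall x, P x.
Proof. by move=> h x; rewrite -(repK x). Qed.

Let q_scale k (x : quotT) : quotT := qproj (k *: rep x).
Let q_mul (x y : quotT) : quotT := qproj (rep x ** rep y).

Let q_scaleE k x : q_scale k (qproj x) = qproj (k *: x).
Proof. by apply/qprojP; rewrite -scalerBr; apply: idealZ; apply: rep_ideal. Qed.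

Let q_mulE x y : q_mul (qproj x) (qproj y) = qproj (x ** y).
Proof.
apply/qprojP; set x' := rep _; set y' := rep _.
have -> : x' ** y' - x ** y = (x' - x) ** y' + x ** (y' - y).
  by rewrite sa_mulDl sa_mulDr sa_mulNl sa_mulNr addrA addrNK.
by apply: idealD; [apply: idealMr | apply: idealMl]; apply: rep_ideal.
Qed.

Let q_scaleA k l x : q_scale k (q_scale l x) = q_scale (k * l) x.
Proof. by elim/q_ind: x => x; rewrite !q_scaleE scalerA. Qed.
Let q_scale1 : left_id 1 q_scale.
Proof. by elim/q_ind=> x; rewrite q_scaleE scale1r. Qed.
Let q_scaleDr : right_distributive q_scale +%R.
Proof.
move=> k; elim/q_ind=> x; elim/q_ind=> y.
by rewrite -qprojD !q_scaleE scalerDr qprojD.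
Qed.
Let q_scaleDl x : {morph q_scale^~ x : k l / k + l}.
Proof. by move=> k l; elim/q_ind: x => x; rewrite !q_scaleE scalerDl qprojD. Qed.

HB.instance Definition _ :=
  GRing.Zmodule_isLmodule.Build K quotT q_scaleA q_scale1 q_scaleDr q_scaleDl.

Let q_mulA : associative q_mul.
Proof.
elim/q_ind=> x; elim/q_ind=> y; elim/q_ind=> z.
by rewrite !q_mulE sa_mulA.
Qed.
Let q_mulDl : left_distributive q_mul +%R.
Proof.
elim/q_ind=> x; elim/q_ind=> y; elim/q_ind=> z.
by rewrite -qprojD !q_mulE sa_mulDl qprojD.
Qed.
Let q_mulDr : right_distributive q_mul +%R.
Proof.
elim/q_ind=> x; elim/q_ind=> y; elim/q_ind=> z.
by rewrite -qprojD !q_mulE sa_mulDr qprojD.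
Qed.
Let q_mulZl k (x y : quotT) : q_mul (k *: x) y = k *: q_mul x y.
Proof.
elim/q_ind: x => x; elim/q_ind: y => y.
change (q_mul (q_scale k (qproj x)) (qproj y) =
        q_scale k (q_mul (qproj x) (qproj y))).
by rewrite q_scaleE !q_mulE q_scaleE sa_mulZl.
Qed.
Let q_mulZr k (x y : quotT) : q_mul x (k *: y) = k *: q_mul x y.
Proof.
elim/q_ind: x => x; elim/q_ind: y => y.
change (q_mul (qproj x) (q_scale k (qproj y)) =
        q_scale k (q_mul (qproj x) (qproj y))).
by rewrite q_scaleE !q_mulE q_scaleE sa_mulZr.
Qed.

Hypothesis S_star : forall x, S x -> ideal x^!.

Lemma ideal_star x : ideal x -> ideal x^!.
Proof.
elim=> {x} [x /S_star //||x y _ hx _ hy|k x _ hx|a x _ hx|a x _ hx].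
- by rewrite sa_star0; apply: ideal0.
- by rewrite sa_starD; apply: idealD.
- by rewrite sa_starZ; apply: idealZ.
- by rewrite sa_starM; apply: idealMr.
- by rewrite sa_starM; apply: idealMl.
Qed.

Let q_star (x : quotT) : quotT := qproj (rep x)^!.

Let q_starE x : q_star (qproj x) = qproj x^!.
Proof.
apply/qprojP; rewrite -sa_starN -sa_starD.
by apply: ideal_star; apply: rep_ideal.
Qed.
Let q_starK : involutive q_star.
Proof. by elim/q_ind=> x; rewrite !q_starE sa_starK. Qed.
Let q_starD : {morph q_star : x y / x + y}.
Proof.
elim/q_ind=> x; elim/q_ind=> y.
by rewrite -qprojD !q_starE sa_starD qprojD.
Qed.
Let q_starZ k (x : quotT) : q_star (k *: x) = cj k *: q_star x.
Proof.
elim/q_ind: x => x.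
change (q_star (q_scale k (qproj x)) = q_scale (cj k) (q_star (qproj x))).
by rewrite q_scaleE !q_starE q_scaleE sa_starZ.
Qed.
Let q_starM x y : q_star (q_mul x y) = q_mul (q_star y) (q_star x).
Proof.
elim/q_ind: x => x; elim/q_ind: y => y.
by rewrite q_mulE !q_starE q_mulE sa_starM.
Qed.

Definition quotAlg : starAlg cj :=
  StarAlg q_mulA q_mulDl q_mulDr q_mulZl q_mulZr q_starK q_starD q_starZ q_starM.

Definition quot_proj : A -> quotAlg := qproj.

Lemma quot_proj_eq0 x : quot_proj x = 0 <-> ideal x.
Proof. exact: qproj_eq0. Qed.

Lemma quot_proj_surj (y : quotAlg) : exists x, y = quot_proj x.
Proof. by exists (rep y); rewrite /quot_proj repK. Qed.

Lemma quot_proj_hom : is_star_hom quot_proj.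
Proof.
split.
- exact: qprojD.
- by move=> k x; rewrite /quot_proj -q_scaleE.
- by move=> x y; rewrite /quot_proj -q_mulE.
- by move=> x; rewrite /quot_proj -q_starE.
Qed.

Lemma quot_lift (B : starAlg cj) (f : A -> B) :
  is_star_hom f -> (forall x, S x -> f x = 0) ->
  exists2 f' : quotAlg -> B, is_star_hom f' & forall x, f' (quot_proj x) = f x.
Proof.
move=> [fD fZ fM fS] fS0.
have f0 : f 0 = 0 by apply: (@addrI _ (f 0)); rewrite -fD !addr0.
have fI x : ideal x -> f x = 0.
  elim=> {x} [x /fS0 //|//|x y _ hx _ hy|k x _ hx|a x _ hx|a x _ hx].
  - by rewrite fD hx hy addr0.
  - by rewrite fZ hx scaler0.
  - by rewrite fM hx sa_mul0r.
  - by rewrite fM hx sa_mul0l.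
pose f' (x : quotAlg) : B := f (rep x).
have f'E x : f' (qproj x) = f x.
  rewrite /f' -[rep _](subrK x) fD fI ?add0r //; exact: rep_ideal.
exists f' => //; split.
- by elim/q_ind=> x; elim/q_ind=> y; rewrite -qprojD !f'E fD.
- by move=> k; elim/q_ind=> x; rewrite [k *: _]q_scaleE !f'E fZ.
- by elim/q_ind=> x; elim/q_ind=> y; rewrite [_ ** _]q_mulE !f'E fM.
- by elim/q_ind=> x; rewrite [_^!]q_starE !f'E fS.
Qed.

End IdealQuotient.

Record sepGraph := SepGraph {
  vert : choiceType;
  edge : choiceType;
  src : edge -> vert;
  rng : edge -> vert;
  Cat : vert -> set (set edge);
  Cat_partition : forall v, partition (Cat v) id (src @^-1` [set v]) }.

Definition Csep (E : sepGraph) : set (set (edge E)) := \bigcup_v Cat v.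
Definition Cfin (E : sepGraph) : set (set (edge E)) :=
  [set X | Csep X /\ finite_set X].
Arguments Cfin : clear implicits.

(* inl e stands for the edge e, inr e for its formal inverse. *)
Definition letter (E : sepGraph) : choiceType := (edge E + edge E)%type.

Definition linv (E : sepGraph) (y : letter E) : letter E :=
  match y with inl e => inr e | inr e => inl e end.
Definition lsrc (E : sepGraph) (y : letter E) : vert E :=
  match y with inl e => src e | inr e => rng e end.
Definition lrng (E : sepGraph) (y : letter E) : vert E := lsrc (linv y).

(* (v, [:: y1; ...; yn]) is the path y1...yn if n > 0, which forces           *)
(* v = s(y1), and the vertex v if n = 0.                                     *)
Definition gpath (E : sepGraph) : choiceType := (vert E * seq (letter E))%type.

Fixpoint is_walk (E : sepGraph) (v : vert E) (w : seq (letter E)) : bool :=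
  if w is y :: w' then (lsrc y == v) && is_walk (lrng y) w' else true.

Section Paths.
Variable E : sepGraph.
Implicit Types (v : vert E) (g h : gpath E) (T : {fset gpath E}).

Definition is_path g : bool := is_walk g.1 g.2.
Definition psrc g : vert E := g.1.
Definition prng g : vert E := last g.1 (map (@lrng E) g.2).
Definition pinv g : gpath E := (prng g, rev (map (@linv E) g.2)).

Definition pprefix g h : bool := (g.1 == h.1) && prefix g.2 h.2.

Definition is_reduced g : Prop :=
  is_path g /\ forall x, ~~ infix [:: x; linv x] g.2.

Fixpoint reduce_word (w : seq (letter E)) : seq (letter E) :=
  if w is x :: w' then
    let u := reduce_word w' in
    if u is y :: u' then if y == linv x then u' else x :: u else [:: x]
  else [::].

(* Meaningful when prng g = psrc h. *)
Definition pmul g h : gpath E := (g.1, reduce_word (g.2 ++ h.2)).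

Definition ends_with (x : letter E) g : Prop := exists w, g.2 = rcons w x.

Definition FC g : Prop :=
  is_reduced g /\
  forall (X : set (edge E)) x y, Csep X -> X x -> X y ->
    ~~ infix [:: inr x; inl y] g.2.
Definition FCat v g : Prop := FC g /\ psrc g = v.

Definition compatible g h : Prop := FC (pmul (pinv h) g).

Definition is_lower T : Prop :=
  forall g h, g \in T -> pprefix h g -> h \in T.

Definition maxT T : {fset gpath E} :=
  [fset g in T | all (fun h => pprefix g h ==> (h == g)) T]%fset.

Definition Xtrees v T : Prop :=
  [/\ T != fset0, forall g, g \in T -> FCat v g, is_lower T
    & forall g h, g \in T -> h \in T -> compatible g h].

(* For e in X in C, the condition |X| > 1 means that [set e] is not in C;    *)
(* LpartP and Lpart_uniq below relate Lpart to the decomposition g = g_L w.  *)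
Definition negligible (y : letter E) : Prop :=
  match y with inl e => Csep [set e] | inr _ => True end.

Definition XLtrees v T : Prop :=
  Xtrees v T /\
  forall g y, g \in maxT T -> ends_with y g -> ~ negligible y.

Fixpoint Lword (w : seq (letter E)) : seq (letter E) :=
  if w is y :: w' then
    let u := Lword w' in
    if (u == [::]) && `[< negligible y >] then [::] else y :: u
  else [::].
Definition Lpart g : gpath E := (g.1, Lword g.2).

Definition DL g T : Prop := XLtrees (psrc g) T /\ Lpart g \in T.

Definition is_Lpart g g' : Prop :=
  [/\ g'.1 = g.1,
      g'.2 = [::] \/
        (exists (e : edge E) (X : set (edge E)),
          [/\ ends_with (inl e) g', Csep X, X e & exists2 f, X f & f <> e])
    & exists2 w, g.2 = g'.2 ++ w & forall y, y \in w -> negligible y].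

Lemma Csep_cover (e : edge E) : exists2 X, Csep X & X e.
Proof.
have [hc _ _] := Cat_partition (src e).
have : cover (Cat (src e)) id e by rewrite hc.
by move=> [X hX Xe]; exists X => //; exists (src e).
Qed.

Lemma Csep_inj (X Y : set (edge E)) e : Csep X -> Csep Y -> X e -> Y e -> X = Y.
Proof.
move=> [v _ hX] [w _ hY] Xe Ye.
have sE u Z : Cat u Z -> Z e -> src e = u.
  move=> hZ Ze; have [hc _ _] := Cat_partition u.
  suff : (@src E @^-1` [set u]) e by [].
  by rewrite -hc; exists Z.
have vw : v = w by rewrite -(sE _ _ hX Xe) (sE _ _ hY Ye).
subst w; have [_ ht _] := Cat_partition v.
by apply: ht => //; exists e.
Qed.

Lemma LpartP g : is_Lpart g (Lpart g).
Proof.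
case: g => v w; split=> //=.
- elim: w => [|y w IH]; first by left.
  rewrite /Lpart /ends_with /=; case: ifPn => [_|]; first by left.
  rewrite negb_and => h; right.
  case: IH => [/= u0|[e [X [[u /= ue] hX Xe hf]]]]; last first.
    by exists e, X; split => //; exists (y :: u); rewrite ue.
  move: h; rewrite u0 eqxx /= => /asboolP hy.
  case: y hy => [e|e] //= hy.
  have [X hX Xe] := Csep_cover e; exists e, X; split=> //.
    by exists [::].
  apply: contrapT => hn; apply: hy; suff <- : X = [set e] by [].
  apply/seteqP; split=> [f Xf /=|f /= -> //].
  by apply: contrapT => fe; apply: hn; exists f.
- elim: w => [|y w [u wu hu]] /=; first by exists [::].
  case: ifP => [/andP[/eqP u0 /asboolP hy]|_].
    exists (y :: w) => // z; rewrite inE => /orP[/eqP -> //|].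
    by rewrite wu u0 /=; apply: hu.
  by exists u => //=; rewrite -wu.
Qed.

Lemma Lpart_uniq g g' : is_Lpart g g' -> g' = Lpart g.
Proof.
case: g g' => [v w] [v' w'] [/= -> hw [u wE hu]]; congr (_, _).
rewrite {}wE; have L0 : Lword u = [::].
  elim: u hu => //= y u IH h; rewrite IH => [|z hz]; last first.
    by apply: h; rewrite inE hz orbT.
  by rewrite eqxx /=; case: asboolP => // -[]; apply: h; rewrite inE eqxx.
case: hw => [-> //|[e [X [[w0 /= ->] hX Xe [f Xf fe]]]]].
elim: w0 => [|y w0 IH] /=.
  rewrite L0 eqxx /=; case: asboolP => // he.
  by case: fe; have : [set e] f by rewrite -(Csep_inj hX he Xe).
by rewrite -IH; case: (w0).
Qed.

(* A choice function is defined on the subtype Cfin only, since edge E may   *)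
(* be empty.                                                                 *)
Definition is_choice (ch : Cfin E -> edge E) : Prop :=
  forall X : Cfin E, (val X : set (edge E)) (ch X).

Definition path_Ereduced (ch : Cfin E -> edge E) g : Prop :=
  FC g /\ forall X : Cfin E, ~ ends_with (inl (ch X)) g.

Definition tree_Ereduced (ch : Cfin E -> edge E) T h : Prop :=
  forall g, g \in maxT T -> g <> h -> path_Ereduced ch g.

End Paths.

Section LeavittPathAlgebra.
Variables (K : comPzRingType) (cj : K -> K) (E : sepGraph).

Definition lpa_gen : Type := (vert E + edge E)%type.

Section Relations.
Variables (A : starAlg cj) (h : lpa_gen -> A).
Local Notation V v := (h (inl v)).
Local Notation D e := (h (inr e)).

(* A relation a = b is recorded as the element a - b. *)
Inductive lpa_rel : A -> Prop :=
| lpa_selfadj v : lpa_rel ((V v)^! - V v)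
| lpa_VV v : lpa_rel (V v ** V v - V v)
| lpa_VW v w : v <> w -> lpa_rel (V v ** V w)
| lpa_SE e : lpa_rel (V (src e) ** D e - D e)
| lpa_ER e : lpa_rel (D e ** V (rng e) - D e)
| lpa_EsS e : lpa_rel ((D e)^! ** V (src e) - (D e)^!)
| lpa_REs e : lpa_rel (V (rng e) ** (D e)^! - (D e)^!)
| lpa_EE (X : set (edge E)) e : Csep X -> X e ->
    lpa_rel ((D e)^! ** D e - V (rng e))
| lpa_EF (X : set (edge E)) e f : Csep X -> X e -> X f -> e <> f ->
    lpa_rel ((D e)^! ** D f)
| lpa_CK v (X : set (edge E)) : Cat v X -> finite_set X ->
    lpa_rel (\sum_(e \in X) D e ** (D e)^! - V v).

Definition lpa_relS : set A := [set x | lpa_rel x \/ lpa_rel x^!].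

Lemma lpa_relS_star x : lpa_relS x -> ideal lpa_relS x^!.
Proof.
move=> hx; apply: ideal_gen; rewrite /lpa_relS /= sa_starK.
by case: hx; [right | left].
Qed.
End Relations.

Definition LPA : starAlg cj :=
  quotAlg (@lpa_relS_star (freeAlg cj lpa_gen) fgen).

Definition lpa (x : lpa_gen) : LPA := quot_proj _ (fgen x).

Lemma lpa_relP x : lpa_rel lpa x -> x = 0.
Proof.
have [pD pZ pM pS] := quot_proj_hom (@lpa_relS_star (freeAlg cj lpa_gen) fgen).
set p := quot_proj _ in pD pZ pM pS *.
have pN x' : p (- x') = - p x' by rewrite -scaleN1r pZ scaleN1r.
have p0 : p 0 = 0 by rewrite -[0 in LHS](scale0r 0) pZ scale0r.
have key y : lpa_rel fgen y -> p y = 0.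
  by move=> hy; apply/quot_proj_eq0; apply: ideal_gen; left.
move=> h; suff [y hy ->] : exists2 y, lpa_rel fgen y & x = p y by apply: key.
case: h => [v|v|v w vw|e|e|e|e|X e hX Xe|X e f hX Xe Xf ef|v X hX fX].
- by eexists; [exact: lpa_selfadj|rewrite pD pN pS].
- by eexists; [exact: lpa_VV|rewrite pD pN pM].
- by eexists; [exact: lpa_VW vw|rewrite pM].
- by eexists; [exact: lpa_SE|rewrite pD pN pM].
- by eexists; [exact: lpa_ER|rewrite pD pN pM].
- by eexists; [exact: lpa_EsS|rewrite pD pN pM pS].
- by eexists; [exact: lpa_REs|rewrite pD pN pM pS].
- by eexists; [exact: lpa_EE hX Xe|rewrite pD pN pM pS].
- by eexists; [exact: lpa_EF hX Xe Xf ef|rewrite pM pS].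
- eexists; first exact: lpa_CK hX fX.
  rewrite pD pN !fsbig_finite //= (big_morph p pD p0); congr (_ - _).
  by apply: eq_bigr => e _; rewrite pM pS.
Qed.

Lemma lpa_universal (A : starAlg cj) (h : lpa_gen -> A) :
  (forall x, lpa_rel h x -> x = 0) ->
  exists2 f : LPA -> A, is_star_hom f & forall x, f (lpa x) = h x.
Proof.
move=> hrel; have [pD pZ pM pS] := free_lift_hom h.
set p := free_lift h in pD pZ pM pS *.
have pg g : p (fgen g) = h g by apply: free_lift_gen.
have pN x' : p (- x') = - p x' by rewrite -scaleN1r pZ scaleN1r.
have p0 : p 0 = 0 by rewrite -[0 in LHS](scale0r 0) pZ scale0r.
have key y : lpa_rel fgen y -> p y = 0.
  move=> hy; apply: hrel.
  case: hy => [v|v|v w vw|e|e|e|e|X e hX Xe|X e f hX Xe Xf ef|v X hX fX].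
  - by rewrite pD pN pS !pg; exact: lpa_selfadj.
  - by rewrite pD pN pM !pg; exact: lpa_VV.
  - by rewrite pM !pg; exact: lpa_VW vw.
  - by rewrite pD pN pM !pg; exact: lpa_SE.
  - by rewrite pD pN pM !pg; exact: lpa_ER.
  - by rewrite pD pN pM pS !pg; exact: lpa_EsS.
  - by rewrite pD pN pM pS !pg; exact: lpa_REs.
  - by rewrite pD pN pM pS !pg; exact: lpa_EE hX Xe.
  - by rewrite pM pS !pg; exact: lpa_EF hX Xe Xf ef.
  - have := lpa_CK h hX fX.
    rewrite pD pN pg !fsbig_finite //= (big_morph p pD p0).
    by under [in X in _ -> X]eq_bigr => e _ do rewrite pM pS !pg.
have [x [/key //|/key hx]|f fh fE] :=
  quot_lift (@lpa_relS_star (freeAlg cj lpa_gen) fgen) (And4 pD pZ pM pS).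
  by rewrite -[x]sa_starK pS hx sa_star0.
by exists f => // x; rewrite fE pg.
Qed.

Lemma lpa_universal_uniq (A : starAlg cj) (f f' : LPA -> A) :
  is_star_hom f -> is_star_hom f' -> (forall x, f (lpa x) = f' (lpa x)) ->
  f =1 f'.
Proof.
move=> [fD fZ fM fS] [gD gZ gM gS] e.
have [pD pZ pM pS] := quot_proj_hom (@lpa_relS_star (freeAlg cj lpa_gen) fgen).
move=> y; have [x ->] := quot_proj_surj y.
set p := quot_proj _ in pD pZ pM pS *.
have -> : f (p x) = free_lift (fun g => f (lpa g)) x.
  apply: (@free_lift_uniq _ _ _ _ (fun g => f (lpa g)) (f \o p)) => //.
  by split=> [a b|k a|a b|a] /=; rewrite ?(pD, pZ, pM, pS) ?(fD, fZ, fM, fS).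
symmetry.
apply: (@free_lift_uniq _ _ _ _ (fun g => f (lpa g)) (f' \o p)) => [|g /=].
  by split=> [a b|k a|a b|a] /=; rewrite ?(pD, pZ, pM, pS) ?(gD, gZ, gM, gS).
by rewrite e.
Qed.

Inductive lpa_sgrp : LPA -> Prop :=
| sgrp_gen x : lpa_sgrp (lpa x)
| sgrp_mul x y : lpa_sgrp x -> lpa_sgrp y -> lpa_sgrp (x ** y)
| sgrp_star x : lpa_sgrp x -> lpa_sgrp x^!.

Definition tame_comm : set LPA :=
  [set c | exists x y, [/\ lpa_sgrp x, lpa_sgrp y &
    c = (x ** x^!) ** (y ** y^!) - (y ** y^!) ** (x ** x^!)]].

Lemma tame_comm_star c : tame_comm c -> ideal tame_comm c^!.
Proof.
move=> [x [y [hx hy ->]]]; apply: ideal_gen; exists y, x; split=> //.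
by rewrite sa_starD sa_starN !sa_starM !sa_starK.
Qed.

Definition LPAab : starAlg cj := quotAlg tame_comm_star.

Definition lpaab (x : lpa_gen) : LPAab := quot_proj _ (lpa x).

Definition letter_elt (y : letter E) : LPAab :=
  match y with
  | inl e => lpaab (inr e)
  | inr e => (lpaab (inr e))^!
  end.

Definition path_elt (g : gpath E) : LPAab :=
  if g.2 is [::] then lpaab (inl g.1) else sa_prod (map letter_elt g.2).

(* The factors commute in LPAab, so the order of the enumeration of maxT T   *)
(* is irrelevant.                                                            *)
Definition tree_elt (T : {fset gpath E}) : LPAab :=
  sa_prod [seq path_elt l ** (path_elt l)^! | l <- enum_fset (maxT T)].

Definition cross_elt (Tg : {fset gpath E} * gpath E) : LPAab :=
  tree_elt Tg.1 ** path_elt Tg.2.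

End LeavittPathAlgebra.

Definition Bbar_index (E : sepGraph) (ch : Cfin E -> edge E) :
    set ({fset gpath E} * gpath E) :=
  [set Tg | [/\ FC Tg.2, DL Tg.2 Tg.1 & tree_Ereduced ch Tg.1 (Lpart Tg.2)]].

(* The basis is a family: over a nonzero ring this includes injectivity of b  *)
(* on J.                                                                     *)
Definition is_basis (K : pzRingType) (M : lmodType K) (I : choiceType)
    (J : set I) (b : I -> M) : Prop :=
  (forall x : M, exists (s : seq I) (c : I -> K),
     (forall i, i \in s -> J i) /\ x = \sum_(i <- s) c i *: b i) /\
  (forall (s : seq I) (c : I -> K),
     uniq s -> (forall i, i \in s -> J i) ->
     \sum_(i <- s) c i *: b i = 0 -> forall i, i \in s -> c i = 0).

(* Main.v *)
Require Import Defs.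
From HB Require Import structures.
From mathcomp Require Import all_boot all_order all_algebra finmap.
From mathcomp Require Import boolp classical_sets functions cardinality fsbigop.

(* Spanning.  In the tame algebra the elements q(w) = w w* of paths w are      *)
(* commuting idempotents; q(w) absorbs q(u) for every prefix u of w, does not *)
(* see a negligible tail of w, and q(u) q(w) = 0 when u, w are incompatible.  *)
(* Hence the products q(w1)...q(wn) g span, and each of them is 0 or e(T) g   *)
(* for the tree T of prefixes of the Lparts.  If a maximal element of T other *)
(* than the Lpart of g is k.ch(X), then q(k.ch X) = q(k) - sum_e q(k.e) with  *)
(* e in X, e <> ch X, rewrites e(T) g in terms of smaller trees.              *)
(*                                                                            *)
(* Independence.  Complete T to an infinite tree xi by taking ch(X) wherever  *)
(* T does not decide the finite block X.  The letters act by right            *)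
(* multiplication as partial bijections of xi, which represents LPAab on the  *)
(* functions on xi.  The coefficient of e(T') g' at (trivial path, g) is 1 if *)
(* g' = g and T' is contained in xi, and 0 otherwise.  For an E-reduced T',   *)
(* containment in xi forces containment in T, so the coefficient matrix is    *)
(* triangular with respect to inclusion.                                      *)

Set Implicit Arguments.
Unset Strict Implicit.
Unset Printing Implicit Defensive.
Import GRing.Theory.

Local Open Scope classical_set_scope.
Local Open Scope ring_scope.

(** * Paths as words *)

(** Spanning is a straightening argument. Tameness makes every element of the star-semigroup
    generated by vertices and edges a partial isometry ([sgrp_pisom]), so the projections q(w)
    commute and absorb along prefixes. Multiplying a monomial q(w1)...q(wn) p(w) on the right by a
    letter extends w, or removes its last letter at the cost of a factor q(w) ([mul_pe_linv]), or
    gives 0 ([mul_pe_L0]); hence the monomials span. [spanned_Qp_pe] writes each of them in basis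
    elements by induction on a weight of its tree, eliminating chosen edges through the
    Cuntz-Krieger relation [qe_CK].

    Independence needs enough representations. A [configuration] is a tree of reduced paths
    satisfying the defining relations locally: at each point all inverse edges are available, and
    from each block at most one edge, exactly one if the block is finite. Letters act on it by
    partial bijections, and [cfg_hom] gives a representation of the tame algebra. For a basis index
    (T, g) the tree T is completed to a configuration ([completionP]). Evaluated at the trivial path
    on the indicator of g, a vanishing combination retains only terms (T', g) with T' inside the
    completion; by [completion_Ereduced] such T' lie in T. Induction on the cardinality of T then
    makes all coefficients zero. *)

Lemma sorted_infix2 (T : eqType) (r : rel T) (w : seq T) :
  sorted r w <-> forall x y, infix [:: x; y] w -> r x y.
Proof.
split.
  elim: w => [|a [|b w] IH] /= => [_ x y //|_ x y|/andP[rab rw] x y].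
  - by rewrite !andbF.
  - case/orP => [|h]; last exact: IH.
    by rewrite prefix0s andbT => /andP[/eqP -> /eqP ->].
elim: w => [|a [|b w] IH] // h; apply/andP; split.
  by apply: h; rewrite /= !eqxx prefix0s.
by apply: IH => x y hxy; apply: h; apply/orP; right.
Qed.

Section Words.
Variable E : sepGraph.
Implicit Types (e f : edge E) (x y : letter E) (u w : seq (letter E)).
Implicit Types (v : vert E) (g h : gpath E) (T : {fset gpath E}).

Lemma linvK : involutive (@linv E). Proof. by case. Qed.

Lemma lsrc_linv y : lsrc (linv y) = lrng y. Proof. by []. Qed.
Lemma lrng_linv y : lrng (linv y) = lsrc y. Proof. by rewrite /lrng linvK. Qed.

Definition same_block e f : bool := `[< exists2 X, Csep X & X e /\ X f >].

Lemma same_blockxx e : same_block e e.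
Proof. by apply/asboolP; have [X hX Xe] := Csep_cover e; exists X. Qed.

Lemma same_blockC e f : same_block e f = same_block f e.
Proof.
by apply/asboolP/asboolP => -[X hX [Xe Xf]]; exists X.
Qed.

Lemma same_blockE (X : set (edge E)) e f :
  Csep X -> X e -> same_block e f <-> X f.
Proof.
move=> hX Xe; split=> [/asboolP[Y hY [Ye Yf]]|Xf].
  by rewrite (Csep_inj hX hY Xe Ye).
by apply/asboolP; exists X.
Qed.

Lemma Cat_Csep v (X : set (edge E)) : Cat v X -> Csep X.
Proof. by move=> hX; exists v. Qed.

Lemma Cat_src v (X : set (edge E)) e : Cat v X -> X e -> src e = v.
Proof.
move=> hX Xe; have [hc _ _] := Cat_partition v.
suff : (@src E @^-1` [set v]) e by [].
by rewrite -hc; exists X.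
Qed.

Lemma Csep_Cat (X : set (edge E)) e : Csep X -> X e -> Cat (src e) X.
Proof. by move=> [v _ hX] Xe; rewrite (Cat_src hX Xe). Qed.

(** Membership in F_C is a condition on consecutive letters. An edge shares its block with itself,
    so the [inr e, inl f] case also forbids the cancelling pair e^-1 e. *)
Definition admissible x y : bool :=
  (lrng x == lsrc y) &&
  match x, y with
  | inr e, inl f => ~~ same_block e f
  | inl e, inr f => e != f
  | _, _ => true
  end.

Definition starts v w : bool := if w is y :: _ then lsrc y == v else true.

Definition FCw v w : bool := starts v w && sorted admissible w.

Definition wrng v w : vert E := last v (map (@lrng E) w).

Lemma is_walkE v w :
  is_walk v w = starts v w && sorted (fun x y => lrng x == lsrc y) w.
Proof.
elim: w v => [|x w IH] v //=; rewrite IH; congr (_ && _).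
by case: w {IH} => //= y w; rewrite eq_sym.
Qed.

Lemma admissible_red x y : admissible x y -> y != linv x.
Proof.
case: x y => [e|e] [f|f] //= /andP[_].
  by apply: contraNneq => -[->].
by apply: contraNneq => -[->]; apply: same_blockxx.
Qed.

Lemma admissible_linv x y : admissible (linv y) (linv x) = admissible x y.
Proof.
rewrite /admissible lrng_linv lsrc_linv eq_sym; congr (_ && _).
by case: x y => [e|e] [f|f] //=; [rewrite eq_sym | rewrite same_blockC].
Qed.

Lemma FCP v w : FC (v, w) <-> FCw v w.
Proof.
rewrite /FCw; split.
  move=> [[/= hp hr] hs]; move: hp; rewrite /is_path is_walkE.
  move=> /andP[-> /sorted_infix2 hw]; apply/sorted_infix2 => x y hxy.
  rewrite /admissible hw //=.
  case: x y hxy => [e|e] [f|f] // hxy.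
    by apply: contraTneq hxy => <-; apply: (hr (inl e)).
  apply: contraL hxy => /asboolP[X hX [Xe Xf]].
  by apply: hs hX Xe Xf.
move=> /andP[hst /sorted_infix2 hw]; split=> [|X e f hX Xe Xf /=].
  split=> [|x /=]; last first.
    by apply/negP => /hw /admissible_red; rewrite eqxx.
  rewrite /is_path /= is_walkE hst; apply/sorted_infix2 => x y /hw.
  by case/andP.
by apply/negP => /hw /andP[_] /negP; apply; apply/asboolP; exists X.
Qed.

Lemma FCP' g : FC g <-> FCw g.1 g.2.
Proof. by case: g => v w; apply: FCP. Qed.

Lemma FCw_prefix v u w : FCw v (u ++ w) -> FCw v u.
Proof.
move=> /andP[h1 /cat_sorted2[h2 _]]; rewrite /FCw h2 andbT.
by case: u h1 {h2}.
Qed.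



Lemma FCw_rcons v w y :
  FCw v (rcons w y) ->
  [/\ FCw v w, wrng v w = lsrc y & forall x w', w = rcons w' x -> admissible x y].
Proof.
case/lastP: w => [|w x]; first by move=> /andP[/eqP /= h _]; split=> // x [].
rewrite /wrng /= map_rcons last_rcons => h.
have hx : admissible x y.
  move: h => /andP[_ /sorted_infix2]; apply.
  by apply/infixP; exists w, [::]; rewrite cats0 -!cats1 -catA.
split.
- by move: h; rewrite -cats1 => /FCw_prefix.
- by case/andP: hx => /eqP.
- by move=> x' w' /rcons_inj[_ <-].
Qed.

Lemma FCw_rconsI v w y :
  FCw v w -> wrng v w = lsrc y ->
  (forall x w', w = rcons w' x -> admissible x y) -> FCw v (rcons w y).
Proof.
case/lastP: w => [|w x]; first by move=> _ h _; rewrite /FCw /= -h eqxx.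
move=> /andP[h1 h2] _ /(_ x w erefl) h; rewrite /FCw.
apply/andP; split; first by case: w h1 {h2}.
by case: w h2 {h1} => [|z w]; rewrite /= ?h // !rcons_path last_rcons h => ->.
Qed.

Lemma wrng_rcons v w y : wrng v (rcons w y) = lrng y.
Proof. by rewrite /wrng map_rcons last_rcons. Qed.

Lemma wrng_cat v u w : wrng v (u ++ w) = wrng (wrng v u) w.
Proof. by rewrite /wrng map_cat last_cat. Qed.

Lemma FCw_catr v u w : FCw v (u ++ w) -> FCw (wrng v u) w.
Proof.
elim/last_ind: u w => [|u x IH] w //; rewrite cat_rcons => /IH.
rewrite wrng_rcons; case: w => //= y w /andP[_ /= /andP[hxy hw]].
by rewrite /FCw /= hw andbT; case/andP: hxy => /eqP ->.
Qed.

(** Compatibility, read off the first place where the words differ ([compatibleP]): the only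
    obstruction is a pair of distinct edges of one block. *)
Fixpoint compw u w : bool :=
  match u, w with
  | x :: u', y :: w' =>
      if x == y then compw u' w' else
      match x, y with inl e, inl f => ~~ same_block e f | _, _ => true end
  | _, _ => true
  end.

Lemma compw_cat k u w : compw (k ++ u) (k ++ w) = compw u w.
Proof. by elim: k => //= x k; rewrite eqxx. Qed.

Lemma compw_prefix u w u' w' : compw (u ++ u') (w ++ w') -> compw u w.
Proof.
elim: u w => [|x u IH] [|y w] //=.
by case: eqP => // _; apply: IH.
Qed.

Lemma common_prefix u w : exists k a b,
  [/\ u = k ++ a, w = k ++ b &
      forall x a' y b', a = x :: a' -> b = y :: b' -> x != y].
Proof.
elim: u w => [|x u IH] w; first by exists [::], [::], w.
case: w => [|y w]; first by exists [::], (x :: u), [::].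
case: (eqVneq x y) => [<-|xy].
  have [k [a [b [-> -> h]]]] := IH w.
  by exists (x :: k), a, b.
by exists [::], (x :: u), (y :: w); split=> // ? ? ? ? [<- _] [<- _].
Qed.

Lemma compwF u w : ~~ compw u w -> exists k e f u' w',
  [/\ u = k ++ inl e :: u', w = k ++ inl f :: w', e <> f & same_block e f].
Proof.
have [k [a [b [-> -> h]]]] := common_prefix u w.
rewrite compw_cat; case: a b h => [|x a] [|y b] //= h.
have /negPf xy := h _ _ _ _ erefl erefl; rewrite xy.
case: x y {h} xy => [e|e] [f|f] // xy; rewrite negbK => hs.
by exists k, e, f, a, b; split=> // ef; rewrite ef eqxx in xy.
Qed.

Local Notation winv w := (rev (map (@linv E) w)).

Lemma reduce_word_catr u w w' :
  reduce_word w = reduce_word w' -> reduce_word (u ++ w) = reduce_word (u ++ w').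
Proof. by move=> h; elim: u => //= x u ->. Qed.

Lemma reduce_word_id w :
  sorted (fun x y => y != linv x) w -> reduce_word w = w.
Proof.
elim: w => [|x w IH] //= h; rewrite IH ?(path_sorted h) //.
by case: w h {IH} => //= y w /andP[/negPf -> _].
Qed.

Lemma FCw_reduced v w : FCw v w -> reduce_word w = w.
Proof.
move=> /andP[_ h]; apply: reduce_word_id; move: h; apply: sub_sorted.
exact: admissible_red.
Qed.

Lemma reduce_word_winv v k w :
  FCw v (k ++ w) -> reduce_word (winv k ++ k ++ w) = w.
Proof.
elim: k v => [|x k IH] v h; first exact: (FCw_reduced h).
have hk : FCw (wrng v [:: x]) (k ++ w) by apply: (FCw_catr (u := [:: x]) h).
rewrite -[RHS](IH _ hk) /= rev_cons cat_rcons.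
apply: reduce_word_catr => /=; move: (FCw_reduced h) => /= ->.
by rewrite linvK eqxx (FCw_reduced hk).
Qed.

Lemma sorted_winv w : sorted admissible (winv w) = sorted admissible w.
Proof.
rewrite rev_sorted sorted_map; apply: eq_sorted => x y /=.
exact: admissible_linv.
Qed.

(** The concatenation creates a single new pair of consecutive letters, y^-1 x, so only this
    junction can fail. *)
Lemma FCw_winv_cat v x a y b :
  FCw v (x :: a) -> FCw v (y :: b) -> x != y ->
  FCw (wrng v (y :: b)) (winv (y :: b) ++ x :: a) = compw (x :: a) (y :: b).
Proof.
move=> /andP[/eqP sx ha] /andP[/eqP sy hb] xy.
rewrite /FCw; have -> : starts (wrng v (y :: b)) (winv (y :: b) ++ x :: a).
  case/lastP: {hb}(y :: b) => [|w z]; first by rewrite /= sx eqxx.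
  by rewrite wrng_rcons map_rcons rev_rcons /= eqxx.
have := hb; rewrite -sorted_winv map_cons rev_cons => hb'.
rewrite cat_rcons sorted_cat_cons hb' /=; move: ha => /= ->.
rewrite andbT (negPf xy) /admissible lrng_linv sx sy eqxx /=.
case: x y {hb hb' sx sy} xy => [e|e] [f|f] //= xy; first by rewrite same_blockC.
by apply: contraNneq xy => ->.
Qed.

(** The common prefix cancels in the reduced product; the remaining words start with different
    letters, so nothing further cancels. *)
Lemma compatibleP v u w :
  FCw v u -> FCw v w -> compatible (v, u) (v, w) <-> compw u w.
Proof.
have [k [a [b [-> -> h]]]] := common_prefix u w => hu hw.
rewrite /compatible /pmul /pinv /= FCP compw_cat.
rewrite map_cat rev_cat -catA.
have -> : reduce_word (winv b ++ winv k ++ k ++ a) = reduce_word (winv b ++ a).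
  apply: reduce_word_catr; rewrite (reduce_word_winv hu).
  by rewrite (FCw_reduced (FCw_catr hu)).
rewrite -[prng _]/(wrng v (k ++ b)) wrng_cat.
have {hu} := FCw_catr hu; have {hw} := FCw_catr hw.
move: (wrng v k) => {}v hb ha.
case: b a h hb ha => [|y b] [|x a] h hb ha.
- by [].
- by rewrite (FCw_reduced ha).
- have h' : sorted admissible (winv (y :: b)).
    by rewrite sorted_winv; case/andP: hb.
  have h2 : FCw (wrng v (y :: b)) (winv (y :: b)).
    rewrite /FCw h' andbT; case/lastP: {h hb h'}(y :: b) => // w' z.
    by rewrite wrng_rcons map_rcons rev_rcons /= eqxx.
  by rewrite cats0 (FCw_reduced h2).
have xy := h _ _ _ _ erefl erefl; rewrite -(FCw_winv_cat ha hb xy).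
suff -> : reduce_word (winv (y :: b) ++ x :: a) = winv (y :: b) ++ x :: a by [].
apply: reduce_word_id.
have red w' : sorted admissible w' -> sorted (fun x y => y != linv x) w'.
  by apply: sub_sorted; apply: admissible_red.
have := red _ (_ : sorted admissible (winv (y :: b))).
rewrite sorted_winv; case/andP: hb => _ -> /(_ isT).
rewrite map_cons rev_cons cat_rcons sorted_cat_cons => ->.
by rewrite /= linvK xy /=; apply: (red (x :: a)); case/andP: ha.
Qed.



Lemma Lword_prefix v w :
  exists2 t, w = Lword w ++ t & forall y, y \in t -> negligible y.
Proof. by have [_ _ [t ht hn]] := LpartP (v, w); exists t. Qed.

Lemma Lword_last w w' y : Lword w = rcons w' y -> ~ negligible y.
Proof.
elim: w w' => [|x w IH] w' /=; first by case: w'.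
case: ifPn => [_|h]; first by case: w'.
case: w' => [|z w'] /= []; last by move=> _ /IH.
by move=> <- L0 hy; rewrite L0 eqxx /= in h; case/asboolP: h.
Qed.

Lemma in_maxT T g :
  g \in maxT T <-> g \in T /\ forall h, h \in T -> pprefix g h -> h = g.
Proof.
rewrite /maxT !inE /=; split.
  move=> /andP[gT /allP h]; split=> // k kT gk.
  by have := h _ kT; rewrite gk /= => /eqP.
move=> [-> h] /=; apply/allP => k kT; apply/implyP => gk; apply/eqP; exact: h.
Qed.

Lemma pprefixP g h : reflect (exists t, h = (g.1, g.2 ++ t)) (pprefix g h).
Proof.
apply: (iffP andP) => [[/eqP h1 /prefixP[t ht]]|[t ->]].
  by exists t; rewrite h1 -ht; case: h h1 {ht}.
by rewrite eqxx; split => //=; apply: prefix_prefix.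
Qed.

Lemma pprefix_trans g h k : pprefix g h -> pprefix h k -> pprefix g k.
Proof.
move=> /pprefixP[t ->] /pprefixP[t' ->]; apply/pprefixP.
by exists (t ++ t'); rewrite /= catA.
Qed.

(** An extension of g of greatest length in the finite set T is maximal. *)
Lemma maxT_above T g : g \in T -> exists2 h, h \in maxT T & pprefix g h.
Proof.
move=> gT.
pose ps : pred T := fun h : T => pprefix g (fsval h).
case: (@arg_maxnP T [` gT]%fset ps (fun h : T => size (fsval h).2)).
  by rewrite /ps /pprefix eqxx prefix_refl.
move=> h /= gh hmax; exists (fsval h) => //.
apply/in_maxT; split; first exact: valP.
move=> k kT /pprefixP[t' ht'].
have := hmax [` kT]%fset; rewrite /ps /= => hk.
have : pprefix g k by apply: pprefix_trans gh _; apply/pprefixP; exists t'.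
move/hk; rewrite ht' /= size_cat -[X in (_ <= X)%N]addn0 leq_add2l leqn0.
by move/nilP => ->; rewrite cats0; case: (fsval h).
Qed.

Lemma maxT_lower T T' : is_lower T' -> {subset maxT T <= T'} -> {subset T <= T'}.
Proof.
by move=> lo h g /maxT_above[k /h kT' gk]; apply: lo kT' gk.
Qed.

End Words.

(** * Relations in the tame algebra *)

Arguments sa_mul : simpl never.
Arguments sa_star : simpl never.

Section TameRelations.
Variables (K : comPzRingType) (cj : K -> K) (E : sepGraph).
Implicit Types (e f : edge E) (x y : letter E) (u w : seq (letter E)).
Implicit Types (v : vert E) (T : {fset gpath E}).
Local Notation A := (LPAab cj E).
Local Notation V v := (lpaab cj (inl v) : A).
Local Notation L y := (letter_elt cj y : A).
Implicit Types a b c : A.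

Let pr : LPA cj E -> A := quot_proj (@tame_comm_star K cj E).

Let pr_hom : is_star_hom pr := quot_proj_hom (@tame_comm_star K cj E).
Let prD : {morph pr : a b / a + b}. Proof. by case: pr_hom. Qed.
Let prZ k (a : LPA cj E) : pr (k *: a) = k *: pr a. Proof. by case: pr_hom. Qed.
Let prM : {morph pr : a b / a ** b}. Proof. by case: pr_hom. Qed.
Let prS : {morph pr : a / a^!}. Proof. by case: pr_hom. Qed.
Let prN : {morph pr : a / - a}.
Proof. by move=> a; rewrite -scaleN1r prZ scaleN1r. Qed.
Let pr0 : pr 0 = 0. Proof. by rewrite -[0 in LHS](scale0r 0) prZ scale0r. Qed.

Let prB (a b : LPA cj E) : lpa_rel (lpa cj (E := E)) (a - b) -> pr a = pr b.
Proof. by move=> /lpa_relP /subr0_eq ->. Qed.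

Lemma V_star v : (V v)^! = V v.
Proof. by rewrite -[LHS]prS; apply: prB; apply: lpa_selfadj. Qed.

Lemma V_mul v : V v ** V v = V v.
Proof. by rewrite -[LHS]prM; apply: prB; apply: lpa_VV. Qed.

Lemma V_mul0 v v' : v <> v' -> V v ** V v' = 0.
Proof.
move=> vv'; rewrite -[LHS]prM -pr0; congr pr; apply: lpa_relP.
exact: lpa_VW.
Qed.

Lemma L_star y : (L y)^! = L (linv y).
Proof. by case: y => e //=; rewrite sa_starK. Qed.

Lemma V_L y : V (lsrc y) ** L y = L y.
Proof.
case: y => e /=; first by rewrite -[LHS]prM; apply: prB; apply: lpa_SE.
by rewrite -[X in _ ** X]prS -[LHS]prM -[RHS]prS; apply: prB; apply: lpa_REs.
Qed.

Lemma L_V y : L y ** V (lrng y) = L y.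
Proof.
by rewrite -[LHS]sa_starK sa_starM V_star L_star V_L -L_star sa_starK.
Qed.

Lemma L_block0 e f : same_block e f -> e <> f -> L (inr e) ** L (inl f) = 0.
Proof.
move=> /asboolP[X hX [Xe Xf]] ef /=.
rewrite -[X in X ** _]prS -[LHS]prM -pr0; congr pr; apply: lpa_relP.
exact: lpa_EF hX Xe Xf ef.
Qed.

Lemma L_inr_inl e : L (inr e) ** L (inl e) = V (rng e).
Proof.
have [X hX Xe] := Csep_cover e.
rewrite /= -[X in X ** _]prS -[LHS]prM; apply: prB; exact: lpa_EE hX Xe.
Qed.

Lemma L_CK v (X : set (edge E)) : Cat v X -> finite_set X ->
  V v = \sum_(e \in X) L (inl e) ** L (inr e).
Proof.
move=> hX fX; rewrite -[LHS](prB (lpa_CK (lpa cj (E := E)) hX fX)).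
rewrite !fsbig_finite //= (big_morph pr prD pr0); apply: eq_bigr => e _.
by rewrite prM prS.
Qed.

(** If the block of an edge is a singleton, its Cuntz-Krieger sum has one term. *)
Lemma L_negligible y : negligible y -> L y ** L (linv y) = V (lsrc y).
Proof.
case: y => e; last by rewrite /= L_inr_inl.
move=> /= he; by rewrite (L_CK (Csep_Cat he _)) //= ?fsbig_set1.
Qed.

Definition sgrp (a : A) : Prop := exists2 b, lpa_sgrp b & a = pr b.

Lemma sgrp_V v : sgrp (V v).
Proof. by eexists; first exact: (sgrp_gen cj (inl v)). Qed.

Lemma sgrpM a b : sgrp a -> sgrp b -> sgrp (a ** b).
Proof.
move=> [a' ha ->] [b' hb ->]; exists (a' ** b'); last by rewrite prM.
exact: sgrp_mul.
Qed.

Lemma sgrpS a : sgrp a -> sgrp a^!.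
Proof.
by move=> [a' ha ->]; exists a'^!; rewrite ?prS //; apply: sgrp_star.
Qed.

Lemma sgrp_L y : sgrp (L y).
Proof.
have h e : sgrp (L (inl e)).
  by eexists; first exact: (sgrp_gen cj (inr e)).
by case: y => e //; apply: (@sgrpS (L (inl e))).
Qed.

Lemma sgrp_comm a b : sgrp a -> sgrp b ->
  (a ** a^!) ** (b ** b^!) = (b ** b^!) ** (a ** a^!).
Proof.
move=> [a' ha ->] [b' hb ->]; rewrite -!prS -!prM.
apply/eqP; rewrite -subr_eq0 -prN -prD; apply/eqP/quot_proj_eq0.
by apply: ideal_gen; exists a', b'.
Qed.

Lemma sgrp_comm' a b : sgrp a -> sgrp b ->
  (a^! ** a) ** (b ** b^!) = (b ** b^!) ** (a^! ** a).
Proof.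
by move=> /sgrpS ha hb; have := sgrp_comm ha hb; rewrite sa_starK.
Qed.

(** Tameness enters here: commuting b* b with c c* turns b c c* b* b c into b b* b c c* c. *)
Lemma sgrp_pisom a : sgrp a -> a ** a^! ** a = a.
Proof.
move=> [z hz ->]; elim: hz => {a z} [[v|e]|b c hb IHb hc IHc|b _ IHb].
- by rewrite -[pr _]/(V v) V_star !V_mul.
- rewrite -[pr _]/(L (inl e)) L_star -sa_mulA L_inr_inl.
  exact: (L_V (inl e)).
- rewrite !prM sa_starM.
  have sb : sgrp (pr b) by exists b.
  have sc : sgrp (pr c) by exists c.
  have cm := sgrp_comm' sb sc.
  rewrite -[RHS](congr2 sa_mul IHb IHc); move: cm.
  move: (pr b) (pr c) => {hb hc IHb IHc sb sc}b {}c cm.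
  transitivity (b ** ((c ** c^!) ** (b^! ** b)) ** c); first by rewrite !sa_mulA.
  by rewrite -cm !sa_mulA.
- rewrite prS sa_starK -[in RHS]IHb; move: (pr b) => c.
  by rewrite !sa_starM sa_starK sa_mulA.
Qed.

(** The leading [V v] replaces a unit, so trivial paths need no separate case. *)
Definition pe v w : A := foldl (fun a y => a ** L y) (V v) w.

Lemma mul_foldlL a b w :
  a ** foldl (fun a y => a ** L y) b w = foldl (fun a y => a ** L y) (a ** b) w.
Proof. by elim: w b => //= y w IH b; rewrite IH sa_mulA. Qed.

Lemma pe_rcons v w y : pe v (rcons w y) = pe v w ** L y.
Proof. by rewrite /pe foldl_rcons. Qed.

Lemma pe_cat v u w : pe v (u ++ w) = foldl (fun a y => a ** L y) (pe v u) w.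
Proof. by rewrite /pe foldl_cat. Qed.

Lemma mul_V_pe v w : V v ** pe v w = pe v w.
Proof. by rewrite /pe mul_foldlL V_mul. Qed.

Lemma mul_pe_V v w : pe v w ** V (wrng v w) = pe v w.
Proof.
case/lastP: w => [|w y]; first exact: V_mul.
by rewrite pe_rcons wrng_rcons -sa_mulA L_V.
Qed.

Lemma path_elt_pe v w : starts v w -> path_elt cj (v, w) = pe v w.
Proof.
case: w => // y w /eqP /= yv; rewrite /path_elt /pe /= -yv V_L.
by elim: w (L y) => //= z w IH b; rewrite IH.
Qed.

Lemma sgrp_pe v w : sgrp (pe v w).
Proof.
elim/last_ind: w => [|w y IH]; first exact: sgrp_V.
by rewrite pe_rcons; apply: sgrpM => //; apply: sgrp_L.
Qed.

(* Locked, since matching modulo sa_mulA would otherwise unfold it. *)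
Definition qe v w : A := locked (pe v w ** (pe v w)^!).

Lemma qeE v w : qe v w = pe v w ** (pe v w)^!.
Proof. by rewrite /qe -lock. Qed.

Lemma qe_nil v : qe v [::] = V v.
Proof. by rewrite !qeE /= V_star V_mul. Qed.

Lemma qeC v u v' w : qe v u ** qe v' w = qe v' w ** qe v u.
Proof. by rewrite !qeE; apply: sgrp_comm; apply: sgrp_pe. Qed.

Lemma mul_V_qe v w : V v ** qe v w = qe v w.
Proof. by rewrite !qeE sa_mulA mul_V_pe. Qed.

Lemma mul_qe_pe v u w : qe v u ** pe v (u ++ w) = pe v (u ++ w).
Proof. by rewrite pe_cat mul_foldlL qeE sgrp_pisom //; apply: sgrp_pe. Qed.

Lemma mul_qe_prefix v u w : qe v u ** qe v (u ++ w) = qe v (u ++ w).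
Proof. by rewrite (qeE v (u ++ w)) sa_mulA mul_qe_pe. Qed.

Lemma qe_idem v w : qe v w ** qe v w = qe v w.
Proof. by have := mul_qe_prefix v w [::]; rewrite cats0. Qed.

Lemma qe_negligible v w y :
  negligible y -> wrng v w = lsrc y -> qe v (rcons w y) = qe v w.
Proof.
move=> hy wy; rewrite !qeE pe_rcons sa_starM L_star sa_mulA -(sa_mulA _ (L y)).
by rewrite L_negligible // -wy mul_pe_V.
Qed.

Lemma qe_Lword v w : FCw v w -> qe v (Lword w) = qe v w.
Proof.
have [t {1 3}-> ht] := Lword_prefix v w.
elim/last_ind: t ht => [|t y IH] ht; first by rewrite cats0.
rewrite -rcons_cat => /FCw_rcons[hw hy _].
rewrite qe_negligible //; last by apply: ht; rewrite mem_rcons inE eqxx.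
by apply: IH => // z hz; apply: ht; rewrite mem_rcons inE hz orbT.
Qed.

(** Write e* as e* e e* and commute e e* past p* p; then e* f = 0 appears. *)
Lemma L_block_sgrp0 p e f : sgrp p -> same_block e f -> e <> f ->
  L (inr e) ** (p^! ** p) ** L (inl f) = 0.
Proof.
move=> hp hef ef; have h := sgrp_comm' hp (sgrp_L (inl e)).
transitivity (L (inr e) ** ((L (inl e) ** (L (inl e))^!) ** (p^! ** p)) ** L (inl f)).
  by rewrite -{1}(sgrp_pisom (sgrp_L (inr e))) !L_star !sa_mulA.
by rewrite -h L_star -!sa_mulA L_block0 // !sa_mul0r.
Qed.

Lemma qe_incompat v u w : ~~ compw u w -> qe v u ** qe v w = 0.
Proof.
move=> /compwF[k [e [f [u' [w' [-> -> ef hef]]]]]].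
suff h : qe v (rcons k (inl e)) ** qe v (rcons k (inl f)) = 0.
  rewrite -!cat_rcons.
  rewrite -(mul_qe_prefix v (rcons k (inl e))) -(mul_qe_prefix v (rcons k (inl f))).
  rewrite (qeC v (rcons k (inl e)) v (_ ++ _)) -sa_mulA (sa_mulA (qe v (rcons k (inl e)))).
  by rewrite h sa_mul0l sa_mul0r.
rewrite !qeE !pe_rcons !sa_starM; set p := pe v k.
transitivity (p ** L (inl e) ** (L (inr e) ** (p^! ** p) ** L (inl f))
              ** ((L (inl f))^! ** p^!)).
  by rewrite -[L (inr e)]/(L (linv (inl e))) -L_star !sa_mulA.
by rewrite (L_block_sgrp0 (sgrp_pe v k) hef ef) sa_mul0r sa_mul0l.
Qed.

(** With p = p(w), p y y* = p p* p y y* = p y y* p* p: cancelling a letter on the right leaves a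
    projection on the left. *)
Lemma mul_pe_linv v w y :
  pe v (rcons w y) ** L (linv y) = qe v (rcons w y) ** pe v w.
Proof.
have h := sgrp_comm' (sgrp_pe v w) (sgrp_L y).
rewrite !qeE !pe_rcons sa_starM -{1}(sgrp_pisom (sgrp_pe v w)) -L_star.
move: h; move: (pe v w) => p h.
transitivity (p ** ((p^! ** p) ** (L y ** (L y)^!))); first by rewrite !sa_mulA.
by rewrite h !sa_mulA.
Qed.

Lemma qe_CK v w (X : set (edge E)) : Cat (wrng v w) X -> finite_set X ->
  qe v w = \sum_(e \in X) qe v (rcons w (inl e)).
Proof.
move=> hX fX; rewrite (qeE v w) -[X in X ** _]mul_pe_V (L_CK hX fX) !fsbig_finite //=.
rewrite (big_morph (sa_mul (pe v w)) (sa_mulDr _) (sa_mul0r _)).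
rewrite (big_morph (sa_mul^~ (pe v w)^!) (fun a b => sa_mulDl a b _) (sa_mul0l _)).
apply: eq_bigr => e _.
by rewrite !qeE pe_rcons sa_starM !sa_mulA.
Qed.

Lemma mul_pe_V0 v w v' : wrng v w <> v' -> pe v w ** V v' = 0.
Proof. by move=> h; rewrite -mul_pe_V -sa_mulA V_mul0 // sa_mul0r. Qed.

(** With cancellation excluded, w y leaves F_C only by a mismatch of vertices or by e^-1 f with e, f
    distinct in one block; both products vanish. *)
Lemma mul_pe_L0 v w y :
  FCw v w -> ~ FCw v (rcons w y) -> (forall w', w <> rcons w' (linv y)) ->
  pe v w ** L y = 0.
Proof.
move=> hw hn hl.
have [wy|/eqP wy] := eqVneq (wrng v w) (lsrc y); last first.
  by rewrite -V_L sa_mulA mul_pe_V0 // sa_mul0l.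
have : ~ (forall x w', w = rcons w' x -> admissible x y).
  by move=> h; apply: hn; apply: FCw_rconsI.
move=> /existsNP[x /existsNP[w' /not_implyP[ew]]].
have := hl w'; rewrite ew pe_rcons -sa_mulA => hl'.
have xy : x <> linv y by move=> xy; apply: hl'; rewrite xy.
rewrite /admissible; move: wy; rewrite ew wrng_rcons => ->; rewrite eqxx /=.
case: x y xy {hn hl hl' ew} => [e|e] [f|f] //=.
- by move=> ef /negP; rewrite negbK => /eqP ef'; case: ef; rewrite ef'.
- move=> ef /negP; rewrite negbK => hs.
  by rewrite (L_block0 hs) ?sa_mul0r // => ef'; case: ef; rewrite ef'.
Qed.

End TameRelations.

(** * Spanning *)

Section Spanned.
Variables (K : pzRingType) (M : lmodType K) (I : choiceType).
Variables (J : set I) (b : I -> M).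

(* Uniqueness of s lets the coefficients of two combinations be added. *)
Definition spanned (x : M) : Prop := exists (s : seq I) (c : I -> K),
  [/\ uniq s, forall i, i \in s -> J i & x = \sum_(i <- s) c i *: b i].

Lemma spanned0 : spanned 0.
Proof. by exists [::], (fun=> 0); split; rewrite ?big_nil. Qed.

Lemma spanned_addl k i x : J i -> spanned x -> spanned (k *: b i + x).
Proof.
move=> Ji [s [c [us Js ->]]]; case: (boolP (i \in s)) => [si|nsi].
  exists s, (fun j => if j == i then k + c j else c j); split=> //.
  rewrite !(bigD1_seq i) //= eqxx scalerDl addrA; congr (_ + _).
  by apply: eq_bigr => j /negPf ->.
exists (i :: s), (fun j => if j == i then k else c j); split=> /=.
- by rewrite nsi.
- by move=> j; rewrite inE => /orP[/eqP -> //|]; apply: Js.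
rewrite big_cons eqxx; congr (_ + _); apply: eq_big_seq => j sj.
by case: eqP sj nsi => // -> ->.
Qed.

Lemma spanned_base i : J i -> spanned (b i).
Proof.
by move=> Ji; rewrite -[b i]addr0 -[b i]scale1r; apply: spanned_addl => //; apply: spanned0.
Qed.

Lemma spannedZ k x : spanned x -> spanned (k *: x).
Proof.
move=> [s [c [us Js ->]]]; exists s, (fun i => k * c i); split=> //.
by rewrite scaler_sumr; apply: eq_bigr => i _; rewrite scalerA.
Qed.

Lemma spannedD x y : spanned x -> spanned y -> spanned (x + y).
Proof.
move=> [s [c [_ Js ->]]] hy; elim: s Js => [|i s IH] Js.
  by rewrite big_nil add0r.
rewrite big_cons -addrA; apply: spanned_addl; first by apply: Js; rewrite inE eqxx.
by apply: IH => j sj; apply: Js; rewrite inE sj orbT.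
Qed.

Lemma spannedB x y : spanned x -> spanned y -> spanned (x - y).
Proof.
by move=> hx hy; apply: spannedD => //; rewrite -scaleN1r; apply: spannedZ.
Qed.

Lemma spanned_sum (I' : eqType) (r : seq I') (P : pred I') (F : I' -> M) :
  (forall i, i \in r -> P i -> spanned (F i)) -> spanned (\sum_(i <- r | P i) F i).
Proof.
move=> h; rewrite big_seq_cond; apply: big_rec => [|i x /andP[ri Pi] hx].
  exact: spanned0.
by apply: spannedD => //; apply: h.
Qed.

End Spanned.

(** * Trees of prefixes of finite families of words *)

Section Trees.
Variable E : sepGraph.
Implicit Types (e f : edge E) (x y : letter E) (u w : seq (letter E)).
Implicit Types (v : vert E) (g h : gpath E) (T : {fset gpath E}).

Definition Lhull v (P : seq (seq (letter E))) : {fset gpath E} :=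
  [fset g in [seq (v, take n (Lword w)) | w <- P, n <- iota 0 (size w).+1]]%fset.

Lemma in_Lhull v P g :
  g \in Lhull v P <-> g.1 = v /\ exists2 w, w \in P & prefix g.2 (Lword w).
Proof.
rewrite /Lhull !inE; split.
  move=> /allpairsPdep[w [n [wP _ ->]]]; split=> //; exists w => //.
  by apply/prefixP; exists (drop n (Lword w)); rewrite cat_take_drop.
move=> [g1 [w wP uw]]; apply/allpairsPdep; exists w, (size g.2).
split=> //; last first.
  by move: uw; rewrite prefixE => /eqP ->; rewrite -g1; case: (g).
rewrite mem_iota /= add0n ltnS; apply: leq_trans (size_prefix uw) _.
have [t {2}-> _] := Lword_prefix v w.
by rewrite size_cat leq_addr.
Qed.

Lemma Lword_in_Lhull v P w : w \in P -> (v, Lword w) \in Lhull v P.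
Proof. by move=> wP; apply/in_Lhull; split=> //; exists w; rewrite ?prefix_refl. Qed.

Lemma FCw_Lword v w : FCw v w -> FCw v (Lword w).
Proof. by have [t {1}-> _] := Lword_prefix v w; apply: FCw_prefix. Qed.

Lemma FCw_sub v u w : prefix u w -> FCw v w -> FCw v u.
Proof. by move=> /prefixP[t ->]; apply: FCw_prefix. Qed.

(** Each element of the hull is a prefix of an [Lword] that is itself in the hull. So the maximal
    elements are [Lword]s, and these do not end in a negligible letter. *)
Lemma Lhull_XL v P : P != [::] -> {in P, forall w, FCw v w} ->
  {in P &, forall u w, compw u w} -> XLtrees v (Lhull v P).
Proof.
move=> P0 hF hc.
have hF' g : g \in Lhull v P -> g = (v, g.2) /\ FCw v g.2.
  case: g => v' u /in_Lhull[/= -> [w wP uw]]; split=> //.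
  by apply: FCw_sub uw _; apply: FCw_Lword; apply: hF.
split; first split.
- case: P P0 {hF hc hF'} => // w P _; apply/fset0Pn; exists (v, Lword w).
  by apply: Lword_in_Lhull; rewrite inE eqxx.
- by move=> g /hF'[-> hg]; split=> //; apply/FCP.
- move=> g h /in_Lhull[g1 [w wP gw]] /andP[/eqP hg1 hg].
  apply/in_Lhull; split; first by rewrite hg1.
  by exists w => //; apply: prefix_trans hg gw.
- move=> g h gT hT; have [-> Fg] := hF' _ gT; have [-> Fh] := hF' _ hT.
  apply/compatibleP => //.
  have /in_Lhull[_ [w wP /prefixP[t et]]] := gT.
  have /in_Lhull[_ [w' w'P /prefixP[t' et']]] := hT.
  have [s es _] := Lword_prefix v w; have [s' es' _] := Lword_prefix v w'.
  have := hc _ _ wP w'P; rewrite es es' et et' -!catA.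
  exact: compw_prefix.
move=> g y /in_maxT[gT gmax] [u gu].
have /in_Lhull[g1 [w wP gw]] := gT.
have := gmax _ (Lword_in_Lhull v wP); rewrite /pprefix g1 eqxx gw /= => /(_ isT).
by move=> eg; move: gu; rewrite -eg /=; apply: Lword_last.
Qed.

End Trees.

(** * Reduction of monomials to basis elements *)

Section TreeElements.
Variables (K : comPzRingType) (cj : K -> K) (E : sepGraph).
Implicit Types (e f : edge E) (x y : letter E) (u w : seq (letter E)).
Implicit Types (v : vert E) (T : {fset gpath E}).
Local Notation A := (LPAab cj E).
Local Notation V v := (lpaab cj (inl v) : A).
Local Notation L y := (letter_elt cj y : A).
Local Notation qe := (@qe K cj E).
Local Notation pe := (@pe K cj E).
Implicit Types (a b c : A) (P : seq (seq (letter E))).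

Definition Qp v P : A := foldr (fun w a => qe v w ** a) (V v) P.

Lemma Qp_cons v w P : Qp v (w :: P) = qe v w ** Qp v P. Proof. by []. Qed.

Lemma mul_V_Qp v P : V v ** Qp v P = Qp v P.
Proof. by case: P => [|w P]; [exact: V_mul | rewrite Qp_cons sa_mulA mul_V_qe]. Qed.

Lemma qe_QpC v u P : qe v u ** Qp v P = Qp v P ** qe v u.
Proof.
elim: P => [|w P IH]; first by rewrite -[Qp v [::]]qe_nil qeC.
rewrite Qp_cons.
by rewrite sa_mulA (qeC cj v u) -!sa_mulA IH.
Qed.

Lemma QpC v P P' : Qp v P ** Qp v P' = Qp v P' ** Qp v P.
Proof.
elim: P => [|w P IH]; first by rewrite -[Qp v [::]]qe_nil qe_QpC.
rewrite Qp_cons.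
by rewrite -sa_mulA IH !sa_mulA qe_QpC.
Qed.

Lemma Qp_absorb v u w P : w \in P -> qe v u ** qe v w = qe v w ->
  qe v u ** Qp v P = Qp v P.
Proof.
move=> wP uw; elim: P wP => // w' P IH; rewrite inE Qp_cons => /orP[/eqP <-|/IH h].
  by rewrite sa_mulA uw.
by rewrite sa_mulA (qeC cj v u) -sa_mulA h.
Qed.

Lemma Qp_cofinal v P P' :
  {in P, forall u, exists2 w, w \in P' & qe v u ** qe v w = qe v w} ->
  Qp v P ** Qp v P' = Qp v P'.
Proof.
elim: P => [|u P IH] h; first exact: mul_V_Qp.
rewrite Qp_cons.
rewrite -sa_mulA IH; last by move=> w wP; apply: h; rewrite inE wP orbT.
have [w wP' uw] := h u (mem_head _ _); exact: Qp_absorb wP' uw.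
Qed.

(** Each product absorbs the other, and they commute. Thus a tree and its maximal elements give the
    same product ([tree_eltE]), as do a family and its hull ([Lhull_Qp]). *)
Lemma Qp_eq v P P' :
  {in P, forall u, exists2 w, w \in P' & qe v u ** qe v w = qe v w} ->
  {in P', forall u, exists2 w, w \in P & qe v u ** qe v w = qe v w} ->
  Qp v P = Qp v P'.
Proof. by move=> /Qp_cofinal h /Qp_cofinal h'; rewrite -h' QpC. Qed.

Lemma Qp_incompat v u w P : u \in P -> w \in P -> ~~ compw u w -> Qp v P = 0.
Proof.
move=> uP wP uw.
rewrite -(Qp_absorb uP (qe_idem cj v u)) -(Qp_absorb wP (qe_idem cj v w)).
by rewrite sa_mulA qe_incompat // sa_mul0l.
Qed.

Definition words T : seq (seq (letter E)) := [seq g.2 | g <- enum_fset T].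

Lemma wordsP T u : reflect (exists2 g, g \in T & u = g.2) (u \in words T).
Proof. exact: mapP. Qed.

Lemma tree_eltE v T : Xtrees v T -> tree_elt cj T = Qp v (words T).
Proof.
move=> [T0 hT lT _].
have hv g : g \in T -> g = (v, g.2) /\ FCw v g.2.
  by case: g => v' u gT; have [/FCP h /= e] := hT _ gT; rewrite -e.
transitivity (Qp v (words (maxT T))); last first.
  apply: Qp_eq => [u /wordsP[g /in_maxT[gT _] ->]|u /wordsP[g gT ->]].
    by exists g.2; [apply/wordsP; exists g | apply: qe_idem].
  have [h hM /pprefixP[t ht]] := maxT_above gT.
  exists h.2; first by apply/wordsP; exists h.
  by rewrite ht /= mul_qe_prefix.
have : all (fun g : gpath E => (g.1 == v) && starts v g.2) (enum_fset (maxT T)).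
  by apply/allP => g /in_maxT[/hv[-> /andP[h _]] _] /=; rewrite eqxx.
have : enum_fset (maxT T) != [::].
  have /fset0Pn[g /maxT_above[h hM _]] := T0.
  by apply: contraTneq hM => M0; rewrite -[h \in _]/(h \in enum_fset _) M0.
rewrite /tree_elt /words; case: (enum_fset _) => // g s _ /=.
have mE (h : gpath E) : (h.1 == v) && starts v h.2 ->
    path_elt cj h ** (path_elt cj h)^! = qe v h.2.
  by case: h => v' u /= /andP[/eqP -> /path_elt_pe ->]; rewrite qeE.
case/andP => /mE -> hs.
have -> : Qp v [seq h.2 | h <- s] = V v ** Qp v [seq h.2 | h <- s].
  by rewrite mul_V_Qp.
rewrite sa_mulA -[V v]qe_nil qeC qe_nil mul_V_qe.
have : qe v g.2 ** V v = qe v g.2 by rewrite -qe_nil qeC qe_nil mul_V_qe.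
elim: s (qe v g.2) hs => [|h s IH] a /= => [_ -> //|/andP[/mE -> hs] aV].
rewrite sa_mulA -IH //.
by rewrite -sa_mulA -qe_nil qeC qe_nil mul_V_qe.
Qed.

Lemma Lhull_Qp v P : {in P, forall w, FCw v w} -> Qp v (words (Lhull v P)) = Qp v P.
Proof.
move=> hF; apply: Qp_eq => [u /wordsP[[v' u'] /in_Lhull[/= _ [w wP /prefixP[t ew]]] ->]|w wP].
  exists w => //; rewrite -(qe_Lword cj (hF _ wP)) ew mul_qe_prefix //.
exists (Lword w); last by rewrite qe_Lword ?qe_idem //; apply: hF.
by apply/wordsP; exists (v, Lword w) => //; apply: Lword_in_Lhull.
Qed.

Variables (ch : Cfin E -> edge E) (hch : is_choice ch).
Local Notation B := (Bbar_index ch).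
Local Notation spanned := (spanned B (@cross_elt K cj E)).

Definition ends_chosen (g : gpath E) : bool :=
  `[< exists X, ends_with (inl (ch X)) g >].

(* Replacing k.ch(X) by k, or by k.e with e <> ch(X), in a tree lowers its    *)
(* weight.                                                                    *)
Definition weight T : nat := (#|` T| + #|` [fset g in T | ends_chosen g]%fset|)%N.

Lemma weight_sub T T' : (T `<=` T')%fset -> (weight T <= weight T')%N.
Proof.
move=> sT; apply: leq_add; apply: fsubset_leq_card => //.
apply/fsubsetP => g; rewrite !inE /= => /andP[gT ->].
by rewrite (fsubsetP sT).
Qed.

Lemma weight_U1 T g : ~~ ends_chosen g -> (weight (g |` T)%fset <= (weight T).+1)%N.
Proof.
move=> hg; rewrite /weight -addSn; apply: leq_add.
  by rewrite cardfsU1; case: (_ \notin _); rewrite ?add1n ?add0n.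
apply: fsubset_leq_card; apply/fsubsetP => h; rewrite !inE /=.
by move=> /andP[/orP[/eqP ->|->] // hh]; rewrite hh in hg.
Qed.

(** An element ending in a chosen edge counts twice, which outweighs the single unit that
    [weight_U1] allows for its replacement. *)
Lemma weight_D1 T g : g \in T -> ends_chosen g -> weight T = (weight (T `\ g)%fset).+2.
Proof.
move=> gT hg; rewrite /weight (cardfsD1 g) gT add1n addSn; congr _.+1.
rewrite (cardfsD1 g [fset h in T | _]%fset) !inE gT hg add1n addnS.
congr (_ + _).+1%N; congr #|` _|; apply/fsetP => h; rewrite !inE /=.
by rewrite andbA.
Qed.

(** Induction on the weight of the hull of w and P. An incompatible family gives 0 and a tree
    reduced relatively to the [Lpart] of w gives a basis element. Otherwise some maximal l = k.ch(X)
    other than that [Lpart] is replaced by k and by the k.e. *)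
Lemma spanned_Qp_pe v P w : FCw v w -> {in P, forall u, FCw v u} ->
  spanned (Qp v P ** pe v w).
Proof.
move: {2}(weight (Lhull v (w :: P))).+1 (ltnSn (weight (Lhull v (w :: P)))) => n.
elim: n P => // n IH P; rewrite ltnS => hn hw hP.
have hwP : {in w :: P, forall u, FCw v u}.
  by move=> u; rewrite inE => /orP[/eqP ->|/hP].
(* The factor q(w) is free because q(w) p(w) = p(w); it puts the [Lpart] of w into the tree. *)
have -> : Qp v P ** pe v w = Qp v (w :: P) ** pe v w.
  rewrite Qp_cons qe_QpC -sa_mulA; congr (_ ** _).
  by have := mul_qe_pe cj v w [::]; rewrite cats0.
have [hc|] := pselect {in w :: P &, forall u u', compw u u'}; last first.
  move=> /existsNP[u /existsNP[u' /not_implyP[uP /not_implyP[uP' /negP huu]]]].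
  by rewrite (Qp_incompat v uP uP' huu) sa_mul0l; apply: spanned0.
have hT : XLtrees v (Lhull v (w :: P)) by apply: Lhull_XL.
have TE : tree_elt cj (Lhull v (w :: P)) = Qp v (w :: P).
  by rewrite (tree_eltE hT.1) Lhull_Qp.
have wT : (v, Lword w) \in Lhull v (w :: P) by apply: Lword_in_Lhull; rewrite inE eqxx.
move: (Lhull v (w :: P)) wT hT TE hn => T wT hT TE hn.
have [hred|] := pselect (tree_Ereduced ch T (Lpart (v, w))).
  rewrite -TE -path_elt_pe; last by case/andP: hw.
  apply: (@spanned_base _ _ _ _ _ (T, (v, w))); split=> //=; exact/FCP.
move=> /existsNP[l /not_implyP[lM /not_implyP[lw hl]]].
have [lT lmax] := (in_maxT T l).1 lM.
have [[_ hTF lT' _] _] := hT.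
have [/FCP' Fl lv] := hTF _ lT.
have [X [k lk]] : exists X, ends_with (inl (ch X)) l.
  by apply: contrapT => h; apply: hl; split; [apply/FCP'|move=> X hX; apply: h; exists X].
have {lv} lE : l = (v, rcons k (inl (ch X))).
  by rewrite -lk -lv; case: (l).
have {Fl} /FCw_rcons[Fk rk hk] : FCw v (rcons k (inl (ch X))) by move: Fl; rewrite lE.
have [Xs Xf] : Csep (val X) /\ finite_set (val X) by have := valP X; rewrite inE.
have XC : Cat (wrng v k) (val X) by rewrite rk; apply: Csep_Cat.
pose P0 := words (T `\ l)%fset.
have kT : (v, k) \in T.
  apply: lT' lT _; rewrite lE; apply/pprefixP; exists [:: inl (ch X)].
  by rewrite cats1.
have kl : (v, k) != l.
  by rewrite lE; apply/eqP => -[/(congr1 size)]; rewrite size_rcons => /n_Sn.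
have kP0 : k \in P0 by apply/wordsP; exists (v, k); rewrite // !inE kl kT.
have QT : Qp v (w :: P) = qe v (rcons k (inl (ch X))) ** Qp v P0.
  rewrite -TE (tree_eltE hT.1) -Qp_cons; apply: Qp_eq => u.
    move=> /wordsP[g gT ->]; exists g.2; last exact: qe_idem.
    rewrite inE; case: (eqVneq g l) => [->|gl]; first by rewrite lE eqxx.
    by apply/orP; right; apply/wordsP; exists g; rewrite // !inE gl gT.
  rewrite inE => /orP[/eqP ->|/wordsP[g]].
    exists (rcons k (inl (ch X))); last exact: qe_idem.
    by apply/wordsP; exists l; rewrite // lE.
  rewrite !inE => /andP[_ gT] ->; exists g.2; last exact: qe_idem.
  by apply/wordsP; exists g.
have qE : qe v (rcons k (inl (ch X))) = qe v k -
    \sum_(e <- fset_set (val X) | e != ch X) qe v (rcons k (inl e)).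
  rewrite (qe_CK cj XC Xf) fsbig_finite //= (bigD1_seq (ch X)) ?fset_uniq //=.
    by rewrite addrK.
  by rewrite in_fset_set // inE; apply: hch.
have hP0 : {in P0, forall u, FCw v u}.
  move=> u /wordsP[g]; rewrite !inE => /andP[_ gT] ->.
  by have [/FCP' h e] := hTF _ gT; rewrite -e.
(* Removing the maximal element l keeps the tree closed under prefixes. *)
have hsub u u' : (v, u') \in (T `\ l)%fset -> prefix u u' -> (v, u) \in (T `\ l)%fset.
  rewrite !inE => /andP[u'l u'T] uu'.
  have uT : (v, u) \in T by apply: lT' u'T _; rewrite /pprefix eqxx.
  rewrite uT andbT; apply: contra_neq u'l => ul; rewrite -ul in lmax *.
  by apply: lmax => //; rewrite /pprefix eqxx.
have Lsub u : prefix (Lword u) u.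
  by have [t {2}-> _] := Lword_prefix v u; apply: prefix_prefix.
have wL : (v, Lword w) \in (T `\ l)%fset.
  by rewrite !inE wT andbT; apply/eqP => h; apply: lw.
have P0L u : u \in P0 -> (v, u) \in (T `\ l)%fset.
  move=> /wordsP[g gT ->]; have := gT; rewrite in_fsetD1 => /andP[_ gT'].
  by have [_ <-] := hTF _ gT'; rewrite /psrc -surjective_pairing.
have hn' : ((weight (T `\ l)%fset).+1 < n)%N.
  by move: hn; rewrite (weight_D1 lT) //; apply/asboolP; exists X, k.
rewrite QT qE sa_mulDl sa_mulNl sa_mulDl sa_mulNl.
rewrite !(big_morph (sa_mul^~ _) (fun a b => sa_mulDl a b _) (sa_mul0l _)).
apply: spannedB.
  (* The term q(k): its hull lies in T without l. *)
  rewrite -Qp_cons; apply: IH => //; last first.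
    by move=> u; rewrite inE => /orP[/eqP ->|/hP0].
  apply: leq_ltn_trans (ltnW hn'); apply: weight_sub.
  apply/fsubsetP => -[v' u] /in_Lhull[/= -> [u' hu' uu']].
  move: hu'; rewrite inE => /orP[/eqP u'w|hu'].
    by move: uu'; rewrite u'w; apply: hsub.
  have u'T : (v, u') \in (T `\ l)%fset.
    by move: hu'; rewrite inE => /orP[/eqP ->|/P0L //]; apply: P0L.
  by apply: hsub u'T _; apply: prefix_trans uu' _.
apply: spanned_sum => e; rewrite in_fset_set // inE => Xe ech.
(* The edges e and ch(X) share source and block, so k.e is in F_C because k.ch(X) is. *)
have Fe : FCw v (rcons k (inl e)).
  apply: FCw_rconsI => //; first exact: esym (Cat_src XC Xe).
  move=> x k' ek; have := hk _ _ ek; rewrite /admissible.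
  rewrite (_ : lsrc (inl e) = lsrc (inl (ch X))); last first.
    by rewrite /= (Cat_src XC Xe) (Cat_src XC (hch X)).
  case: x {ek} => // f /andP[-> /=]; apply: contra => hfe.
  rewrite same_blockC in hfe.
  have Xf' := (@same_blockE _ _ _ f Xs Xe).1 hfe.
  exact: (@same_blockE _ _ _ (ch X) Xs Xf').2 (hch X).
rewrite -Qp_cons; apply: IH => //; last first.
  by move=> u; rewrite inE => /orP[/eqP ->|/hP0].
(* The term q(k.e): its hull gains at most k.e over T without l, and e is not chosen, since a chosen
   edge determines its block. *)
apply: leq_ltn_trans hn'; apply: leq_trans (weight_U1 _ (g := (v, rcons k (inl e))) _).
  apply: weight_sub.
  apply/fsubsetP => -[v' u] /in_Lhull[/= -> [u' hu' uu']].
  rewrite in_fset1U; apply/orP.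
  move: hu'; rewrite inE => /orP[/eqP u'w|].
    by right; move: uu'; rewrite u'w; apply: hsub.
  rewrite inE => /orP[/eqP u'E|hu']; last first.
    by right; apply: hsub (P0L _ hu') _; apply: prefix_trans uu' _.
  have : prefix u (rcons k (inl e)) by rewrite -u'E; apply: prefix_trans uu' _.
  move=> /prefixP[t]; case/lastP: t => [|t z]; first by rewrite cats0 => ->; left.
  rewrite -rcons_cat => /rcons_inj[kE _]; right; apply: hsub (P0L _ kP0) _.
  by rewrite kE prefix_prefix.
apply/asboolP => -[X' [k' /= /rcons_inj[_ eX']]].
case/eqP: ech; rewrite eX'; congr (ch _); apply: val_inj.
have [Xs' _] : Csep (val X') /\ finite_set (val X') by have := valP X'; rewrite inE.
by apply: (Csep_inj Xs' Xs (hch X')); rewrite -eX'.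
Qed.

(** Arbitrary finite families P are allowed, so that right multiplication by a letter preserves the
    span. *)
Inductive monospan : A -> Prop :=
| monospan0 : monospan 0
| monospan_add k v P w (x : A) : FCw v w -> {in P, forall u, FCw v u} ->
    monospan x -> monospan (k *: (Qp v P ** pe v w) + x).

Lemma monospan_spanned (x : A) : monospan x -> spanned x.
Proof.
elim=> [|k v P w {}x hw hP _ IH]; first exact: spanned0.
by apply: spannedD => //; apply: spannedZ; apply: spanned_Qp_pe.
Qed.

Lemma monospanD (x y : A) : monospan x -> monospan y -> monospan (x + y).
Proof.
move=> hx hy; elim: hx => [|k v P w {}x hw hP _ IH]; first by rewrite add0r.
by rewrite -addrA; apply: monospan_add.
Qed.

Lemma monospanZ k (x : A) : monospan x -> monospan (k *: x).
Proof.
elim=> [|l v P w {}x hw hP _ IH]; first by rewrite scaler0; apply: monospan0.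
by rewrite scalerDr scalerA; apply: monospan_add.
Qed.

Lemma monospan_base v P w : FCw v w -> {in P, forall u, FCw v u} ->
  monospan (Qp v P ** pe v w).
Proof.
move=> hw hP; rewrite -[_ ** _]scale1r -[_ *: _]addr0.
by apply: monospan_add => //; apply: monospan0.
Qed.

Definition rmul_stable (a : A) : Prop := forall x : A, monospan x -> monospan (x ** a).

Lemma rmul_stableI a :
  (forall v P w, FCw v w -> {in P, forall u, FCw v u} ->
     monospan (Qp v P ** pe v w ** a)) -> rmul_stable a.
Proof.
move=> h x; elim=> [|k v P w {}x hw hP _ IH].
  by rewrite sa_mul0l; apply: monospan0.
rewrite sa_mulDl sa_mulZl; apply: monospanD => //.
by apply: monospanZ; apply: h.
Qed.

Lemma rmul_stable_V v : rmul_stable (V v).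
Proof.
apply: rmul_stableI => v' P w hw hP; rewrite -sa_mulA.
case: (eqVneq (wrng v' w) v) => [<-|/eqP h].
  by rewrite mul_pe_V; apply: monospan_base.
by rewrite mul_pe_V0 // sa_mul0r; apply: monospan0.
Qed.

Lemma rmul_stable_L y : rmul_stable (L y).
Proof.
apply: rmul_stableI => v P w hw hP; rewrite -sa_mulA.
have [[w' ew]|hl] := pselect (exists w', w = rcons w' (linv y)).
  have := mul_pe_linv cj v w' (linv y); rewrite linvK -ew => ->.
  rewrite sa_mulA -qe_QpC -Qp_cons; apply: monospan_base.
    by move: hw; rewrite ew -cats1; apply: FCw_prefix.
  by move=> u; rewrite inE => /orP[/eqP ->|/hP].
case: (boolP (FCw v (rcons w y))) => [hwy|/negP hwy].
  by rewrite -pe_rcons; apply: monospan_base.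
rewrite mul_pe_L0 ?sa_mul0r //; first exact: monospan0.
by move=> w' ew; apply: hl; exists w'.
Qed.

Lemma monospan_pe v w : FCw v w -> monospan (pe v w).
Proof. by move=> hw; rewrite -mul_V_pe; apply: (monospan_base (P := [::])). Qed.

Lemma monospan_L y : monospan (L y).
Proof.
have -> : L y = pe (lsrc y) [:: y] by rewrite -[RHS]/(V (lsrc y) ** L y) V_L.
by apply: monospan_pe; rewrite /FCw /= eqxx.
Qed.

Lemma LPAab_teval (a : A) : exists t, a = teval (@lpaab K cj E) t.
Proof.
have [b ->] := quot_proj_surj a; have [c ->] := quot_proj_surj b.
exists (repr (c : freeT _ _)); rewrite -/(free_lift (@lpaab K cj E) c).
have [pD pZ pM pS] := quot_proj_hom (@lpa_relS_star K cj E (freeAlg cj (lpa_gen E)) fgen).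
have [qD qZ qM qS] := quot_proj_hom (@tame_comm_star K cj E).
pose f (x : freeAlg cj (lpa_gen E)) : A :=
  quot_proj (@tame_comm_star K cj E)
    (quot_proj (@lpa_relS_star K cj E (freeAlg cj (lpa_gen E)) fgen) x).
apply: (@free_lift_uniq _ _ _ A (@lpaab K cj E) f) => //.
split=> [x y|k x|x y|x]; rewrite /f.
- by rewrite pD qD.
- by rewrite pZ qZ.
- by rewrite pM qM.
- by rewrite pS qS.
Qed.

Lemma LPAab_spanned (a : A) : spanned a.
Proof.
apply: monospan_spanned; have [t ->] := LPAab_teval a.
(* Only right multiplication is controlled and the star reverses products, so the four claims must
   go through the induction together. *)
suff : [/\ rmul_stable (teval (@lpaab K cj E) t),
           rmul_stable (teval (@lpaab K cj E) t)^!,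
           monospan (teval (@lpaab K cj E) t)
         & monospan (teval (@lpaab K cj E) t)^!] by case.
elim: t => [[v|e]||t [rt rts mt mts] u [ru rus mu mus]|k t [rt rts mt mts]
           |t [rt rts mt mts] u [ru rus mu mus]|t [rt rts mt mts]].
- have mV : monospan (V v) by apply: (monospan_pe (w := [::])).
  by rewrite -[teval _ _]/(V v) V_star; split=> //; apply: rmul_stable_V.
- rewrite -[teval _ _]/(L (inl e)) L_star.
  by split; by [apply: rmul_stable_L | apply: monospan_L].
- rewrite -[teval _ _]/(0 : A) sa_star0; split; try exact: monospan0.
    by move=> x _; rewrite sa_mul0r; apply: monospan0.
  by move=> x _; rewrite sa_mul0r; apply: monospan0.
- rewrite -[teval _ _]/(teval _ t + teval _ u) sa_starD; split.
  + by move=> x hx; rewrite sa_mulDr; apply: monospanD; [apply: rt | apply: ru].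
  + by move=> x hx; rewrite sa_mulDr; apply: monospanD; [apply: rts | apply: rus].
  + exact: monospanD.
  + exact: monospanD.
- rewrite -[teval _ _]/(k *: teval _ t) sa_starZ; split.
  + by move=> x hx; rewrite sa_mulZr; apply: monospanZ; apply: rt.
  + by move=> x hx; rewrite sa_mulZr; apply: monospanZ; apply: rts.
  + exact: monospanZ.
  + exact: monospanZ.
- rewrite -[teval _ _]/(teval _ t ** teval _ u) sa_starM; split.
  + by move=> x hx; rewrite sa_mulA; apply: ru; apply: rt.
  + by move=> x hx; rewrite sa_mulA; apply: rts; apply: rus.
  + exact: ru.
  + exact: rts.
- by rewrite -[teval _ _]/(teval _ t)^! sa_starK.
Qed.

End TreeElements.

(** * Linear independence *)

Section LinearEndomorphisms.
Variables (K : comPzRingType) (Y : Type).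

Definition lin_pred : {pred ((Y -> K^o) -> (Y -> K^o))} := fun a => `[< linear a >].

Lemma lin_pred_submod : submod_closed lin_pred.
Proof.
split=> [|k a b /asboolP la /asboolP lb]; apply/asboolP => l x y.
  by rewrite scaler0 addr0.
rewrite !fctE /=; apply/funext => h.
have -> : a (l *: x + y) = l *: a x + a y by apply: la.
have -> : b (l *: x + y) = l *: b x + b y by apply: lb.
rewrite !fctE. by rewrite !scalerDr !scalerA addrACA (mulrC k).
Qed.

HB.instance Definition _ :=
  GRing.isSubmodClosed.Build K ((Y -> K^o) -> (Y -> K^o)) lin_pred lin_pred_submod.

Record linEnd := LinEnd { lin_fun :> (Y -> K^o) -> (Y -> K^o); _ : lin_fun \in lin_pred }.

HB.instance Definition _ := [isSub for lin_fun].
HB.instance Definition _ := [Choice of linEnd by <:].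
HB.instance Definition _ := [SubChoice_isSubLmodule of linEnd by <:].

Lemma linEndP (a : linEnd) k x y : a (k *: x + y) = k *: a x + a y.
Proof. by case: a => f /= /asboolP ->. Qed.

Lemma linEnd_ext (a b : linEnd) : (forall x h, a x h = b x h) -> a = b.
Proof. by move=> ab; apply: val_inj; apply/funext => x; apply/funext => h; apply: ab. Qed.

Fact lin_comp_subproof (a b : linEnd) : a \o b \in lin_pred.
Proof. by apply/asboolP => k x y /=; rewrite !linEndP. Qed.
Definition lin_comp a b : linEnd := LinEnd (lin_comp_subproof a b).

(** Precomposition reverses composition, so doing f and then g becomes the product of f and g in
    that order, as a right action requires. *)
Definition precomp_fun (f : Y -> option Y) (x : Y -> K^o) : Y -> K^o :=
  fun h => if f h is Some h' then x h' else 0.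

Fact precomp_subproof f : precomp_fun f \in lin_pred.
Proof.
apply/asboolP => k x y; apply/funext => h; rewrite /precomp_fun !fctE.
by case: (f h) => // ; rewrite scaler0 addr0.
Qed.
Definition precomp f : linEnd := LinEnd (precomp_subproof f).

Definition pcomp (f g : Y -> option Y) : Y -> option Y := fun h => obind g (f h).

Lemma lin_comp_precomp f g : lin_comp (precomp f) (precomp g) = precomp (pcomp f g).
Proof.
apply: linEnd_ext => x h /=; rewrite /precomp_fun /pcomp.
by case: (f h).
Qed.

End LinearEndomorphisms.

(* R x R^op with the swap as involution, R being the linear endomorphisms of *)
(* the functions on Y; scaling is twisted by cj on the second factor.         *)
Section SwapAlgebra.
Variables (K : comPzRingType) (cj : {rmorphism K -> K}) (Y : Type).
Hypothesis cjK : involutive cj.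

(** The vacuous [let] makes the type depend on [cj], so that it can carry the twisted scaling. *)
Definition swapT : Type := let _ := cj in (linEnd K Y * linEnd K Y)%type.
HB.instance Definition _ := GRing.Zmodule.copy swapT (linEnd K Y * linEnd K Y)%type.

Let sw_scale (k : K) (x : swapT) : swapT := (k *: x.1, cj k *: x.2).
Let sw_scaleA k l x : sw_scale k (sw_scale l x) = sw_scale (k * l) x.
Proof. by rewrite /sw_scale /= !scalerA rmorphM. Qed.
Let sw_scale1 : left_id 1 sw_scale.
Proof. by case=> a b; rewrite /sw_scale /= rmorph1 !scale1r. Qed.
Let sw_scaleDr : right_distributive sw_scale +%R.
Proof. by move=> k [a b] [c d]; rewrite /sw_scale /= !scalerDr. Qed.
Let sw_scaleDl x : {morph sw_scale^~ x : k l / k + l}.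
Proof. by move=> k l; rewrite /sw_scale /= rmorphD !scalerDl. Qed.
HB.instance Definition _ :=
  GRing.Zmodule_isLmodule.Build K swapT sw_scaleA sw_scale1 sw_scaleDr sw_scaleDl.

Let sw_mul (x y : swapT) : swapT := (lin_comp x.1 y.1, lin_comp y.2 x.2).
Let sw_star (x : swapT) : swapT := (x.2, x.1).

Let lin_compA : associative (@lin_comp K Y).
Proof. by move=> a b c; apply: linEnd_ext. Qed.
Let lin_compDl : left_distributive (@lin_comp K Y) +%R.
Proof. by move=> a b c; apply: linEnd_ext. Qed.
Let lin_compDr : right_distributive (@lin_comp K Y) +%R.
Proof.
move=> a b c; apply: linEnd_ext => x h.
by have := linEndP a 1 (b x) (c x); rewrite !scale1r => /(congr1 (@^~ h)).
Qed.
Let lin_compZl k a b : @lin_comp K Y (k *: a) b = k *: lin_comp a b.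
Proof. by apply: linEnd_ext. Qed.
Let lin_compZr k a b : @lin_comp K Y a (k *: b) = k *: lin_comp a b.
Proof.
apply: linEnd_ext => x h /=.
have a0 : a 0 = 0 by have := linEndP a (-1) 0 0; rewrite scaler0 addr0 scaleN1r addNr.
by have := linEndP a k (b x) 0; rewrite a0 !addr0 => ->.
Qed.

Let sw_mulA : associative sw_mul.
Proof. by move=> [a b] [c d] [e f]; rewrite /sw_mul /= !lin_compA. Qed.
Let sw_mulDl : left_distributive sw_mul +%R.
Proof. by move=> [a b] [c d] [e f]; rewrite /sw_mul /= lin_compDl lin_compDr. Qed.
Let sw_mulDr : right_distributive sw_mul +%R.
Proof. by move=> [a b] [c d] [e f]; rewrite /sw_mul /= lin_compDl lin_compDr. Qed.
Let sw_mulZl (k : K) (x y : swapT) : sw_mul (k *: x) y = k *: sw_mul x y.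
Proof.
by case: x y => [a b] [c d]; rewrite /sw_mul /= lin_compZl lin_compZr.
Qed.
Let sw_mulZr (k : K) (x y : swapT) : sw_mul x (k *: y) = k *: sw_mul x y.
Proof.
by case: x y => [a b] [c d]; rewrite /sw_mul /= lin_compZl lin_compZr.
Qed.
Let sw_starK : involutive sw_star. Proof. by case. Qed.
Let sw_starD : {morph sw_star : x y / x + y}. Proof. by case=> a b []. Qed.
Let sw_starZ (k : K) (x : swapT) : sw_star (k *: x) = cj k *: sw_star x.
Proof.
case: x => a b; rewrite -[RHS]/(cj k *: b, cj (cj k) *: a : linEnd K Y).
by rewrite cjK.
Qed.
Let sw_starM x y : sw_star (sw_mul x y) = sw_mul (sw_star y) (sw_star x).
Proof. by []. Qed.

Definition swapAlg : starAlg cj :=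
  StarAlg sw_mulA sw_mulDl sw_mulDr sw_mulZl sw_mulZr sw_starK sw_starD sw_starZ sw_starM.

Definition swap_pair (f g : Y -> option Y) : swapAlg := (precomp K f, precomp K g).

Lemma swap_pair_mul f g f' g' :
  swap_pair f g ** swap_pair f' g' = swap_pair (pcomp f f') (pcomp g' g).
Proof. by rewrite /swap_pair -!lin_comp_precomp. Qed.

Lemma swap_pair_star f g : (swap_pair f g)^! = swap_pair g f.
Proof. by []. Qed.

Lemma swap_pair0 : swap_pair (fun=> None) (fun=> None) = 0.
Proof. by congr pair; apply: linEnd_ext. Qed.

Definition partial_inverse (f g : Y -> option Y) : Prop :=
  forall h h', f h = Some h' <-> g h' = Some h.

Definition is_pinj (x : swapAlg) : Prop :=
  exists f g, partial_inverse f g /\ x = swap_pair f g.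

Lemma pinj_mul x y : is_pinj x -> is_pinj y -> is_pinj (x ** y).
Proof.
move=> [f [f' [hf ->]]] [g [g' [hg ->]]].
exists (pcomp f g), (pcomp g' f'); split; last exact: swap_pair_mul.
move=> h h'; rewrite /pcomp; split.
  case fE : (f h) => [k|] //= /hg -> /=; exact/hf.
case gE : (g' h') => [k|] //= /hf -> /=; exact/hg.
Qed.

Lemma pinj_star x : is_pinj x -> is_pinj x^!.
Proof.
move=> [f [f' [hf ->]]]; exists f', f; split; last exact: swap_pair_star.
by move=> h h'; split=> /hf.
Qed.

Definition restr (D : pred Y) : Y -> option Y := fun h => if D h then Some h else None.

Lemma restrC D D' : pcomp (restr D) (restr D') = pcomp (restr D') (restr D).
Proof.
apply/funext => h; rewrite /pcomp /restr.
by case Dh: (D h); case Dh': (D' h); rewrite /= ?Dh ?Dh'.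
Qed.

Lemma pcomp_inverse f g : partial_inverse f g -> pcomp f g = restr (fun h => f h : bool).
Proof.
move=> fg; apply/funext => h; rewrite /pcomp /restr.
by case fE : (f h) => [k|] //=; apply/fg.
Qed.

(** Both components of x x* come from the identity restricted to a subset, and such restrictions
    commute. This yields the tame relations. *)
Lemma pinj_comm x y : is_pinj x -> is_pinj y ->
  (x ** x^!) ** (y ** y^!) = (y ** y^!) ** (x ** x^!).
Proof.
move=> [f [f' [hf ->]]] [g [g' [hg ->]]].
rewrite !swap_pair_star !swap_pair_mul (pcomp_inverse hf) (pcomp_inverse hg).
by congr swap_pair; apply: restrC.
Qed.

End SwapAlgebra.

(** * Representations on infinite trees *)

Section Configurations.
Variables (E : sepGraph) (v0 : vert E).
Implicit Types (e f : edge E) (x y : letter E) (m w : seq (letter E)).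

(* Paths starting at v0 are stored with their last letter first, so that the *)
(* right action of a letter is a push or a pop.                              *)
Definition act y m : seq (letter E) :=
  if m is z :: m' then if y == linv z then m' else y :: m else [:: y].

Definition rrng m : vert E := if m is y :: _ then lrng y else v0.

(** [cfg_inr] encodes e* e = r(e), [cfg_uniq] encodes e* f = 0 within a block, and [cfg_ex] together
    with [cfg_uniq] the sum over a finite block. Through [act], an edge just traversed backwards
    counts as the one selected in its block. *)
Record configuration (xi : pred (seq (letter E))) : Prop := Configuration {
  cfg_nil : xi [::];
  cfg_tail y m : xi (y :: m) -> xi m;
  cfg_path y m : xi (y :: m) -> rrng m = lsrc y;
  cfg_reduced x y m : xi (y :: x :: m) -> y != linv x;
  cfg_inr e m : xi m -> rrng m = rng e -> xi (act (inr e) m);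
  cfg_uniq e f m : xi m -> rrng m = src e -> same_block e f ->
    xi (act (inl e) m) -> xi (act (inl f) m) -> e = f;
  cfg_ex (X : set (edge E)) m : xi m -> Cat (rrng m) X -> finite_set X ->
    exists2 e, X e & xi (act (inl e) m) }.

Variables (xi : pred (seq (letter E))) (cxi : configuration xi).

Definition fv (v : vert E) : seq (letter E) -> option (seq (letter E)) :=
  restr (fun m => xi m && (rrng m == v)).

Definition fl y m : option (seq (letter E)) :=
  if [&& xi m, rrng m == lsrc y & xi (act y m)] then Some (act y m) else None.

Lemma rrng_act y m : xi m -> rrng m = lsrc y -> rrng (act y m) = lrng y.
Proof.
case: m => [|z m] //= hm hz; case: eqP => [->|//].
by rewrite (cfg_path cxi hm) lrng_linv.
Qed.

(** Reducedness matters when y pops a letter: pushing that letter back must not cancel the one below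
    it. *)
Lemma actK y m : xi m -> act (linv y) (act y m) = m.
Proof.
case: m => [|z m] hm /=; first by rewrite eqxx.
case: eqP => [->|_] /=; last by rewrite eqxx.
rewrite linvK; case: m hm => // x m hm /=.
by rewrite (negPf (cfg_reduced cxi hm)).
Qed.

Lemma fl_inverse y : partial_inverse (fl y) (fl (linv y)).
Proof.
have key z m m' : fl z m = Some m' -> fl (linv z) m' = Some m.
  rewrite /fl; case: ifP => // /and3P[hm /eqP hz hz'] [<-].
  by rewrite hz' rrng_act // eqxx actK // hm.
by move=> m m'; split=> /key //; rewrite linvK.
Qed.

Lemma fv_inverse v : partial_inverse (fv v) (fv v).
Proof.
have key m m' : fv v m = Some m' -> fv v m' = Some m.
  by rewrite /fv /restr; case: ifP => // h [<-]; rewrite h.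
by move=> m m'; split=> /key.
Qed.

Lemma pcomp_fv v v' : v <> v' -> pcomp (fv v) (fv v') = fun=> None.
Proof.
move=> vv'; apply/funext => m; rewrite /pcomp /fv /restr.
case: ifP => //= /andP[hm /eqP hv].
by rewrite hm hv (introF eqP vv').
Qed.

Lemma pcomp_fvv v : pcomp (fv v) (fv v) = fv v.
Proof.
apply/funext => m; rewrite /pcomp /fv /restr.
by case: ifP => //= ->.
Qed.

Lemma pcomp_fv_fl y : pcomp (fv (lsrc y)) (fl y) = fl y.
Proof.
apply/funext => m; rewrite /pcomp /fv /restr /fl.
by case hm: (xi m) => //=; case hy: (rrng m == lsrc y) => //=; rewrite hm hy.
Qed.

Lemma pcomp_fl_fv y : pcomp (fl y) (fv (lrng y)) = fl y.
Proof.
apply/funext => m; rewrite /pcomp /fl; case: ifP => //= /and3P[hm /eqP hy hy'].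
by rewrite /fv /restr hy' rrng_act // eqxx.
Qed.

Lemma pcomp_fl_inr e : pcomp (fl (inr e)) (fl (inl e)) = fv (rng e).
Proof.
rewrite pcomp_inverse; last exact: fl_inverse.
apply/funext => m; rewrite /fv /restr /fl.
case hm : (xi m) => //=; case: eqP => //= hr.
by rewrite (cfg_inr cxi hm hr).
Qed.

Lemma pcomp_fl_block e f : same_block e f -> e <> f ->
  pcomp (fl (inr e)) (fl (inl f)) = fun=> None.
Proof.
move=> ef nef; apply/funext => m; rewrite /pcomp /fl.
case: ifP => //= /and3P[hm /eqP hr he]; case: ifP => //= /and3P[_ /eqP hr' hf].
case: nef; apply: (cfg_uniq cxi he) _ ef _ hf; first exact: (@rrng_act (inr e) m hm hr).
by have := actK (inr e) hm => /= ->.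
Qed.

Variables (K : comPzRingType) (cj : {rmorphism K -> K}) (cjK : involutive cj).
Local Notation S := (@swapAlg K cj (seq (letter E)) cjK).
Local Notation swap := (@swap_pair K cj (seq (letter E)) cjK).

Definition cfg_gen (x : lpa_gen E) : S :=
  match x with
  | inl v => swap (fv v) (fv v)
  | inr e => swap (fl (inl e)) (fl (inr e))
  end.

Lemma swap_sum (I : Type) (r : seq I) (P : pred I) (F : I -> S) :
  \sum_(i <- r | P i) F i =
  (\sum_(i <- r | P i) (F i).1, \sum_(i <- r | P i) (F i).2) :> S.
Proof.
elim: r => [|i r IH]; first by rewrite !big_nil.
by rewrite !big_cons IH; case: (P i) => //; case: (F i).
Qed.

Lemma linEnd_sum (I : Type) (r : seq I) (P : pred I)
    (F : I -> linEnd K (seq (letter E))) (x : seq (letter E) -> K^o) h :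
  (\sum_(i <- r | P i) F i) x h = \sum_(i <- r | P i) F i x h.
Proof.
by apply: (big_morph (fun a : linEnd K (seq (letter E)) => a x h)).
Qed.

Lemma cfg_gen_rel (x : S) : lpa_rel cfg_gen x -> x = 0.
Proof.
case=> [v|v|v w vw|e|e|e|e|X e hX Xe|X e f hX Xe Xf ef|v X hX fX];
  apply/eqP; rewrite ?subr_eq0; apply/eqP; rewrite ?swap_pair_star ?swap_pair_mul //.
- by rewrite !pcomp_fvv.
- by rewrite !pcomp_fv ?swap_pair0 // => /esym.
- by rewrite (pcomp_fv_fl (inl e)) (pcomp_fl_fv (inr e)).
- by rewrite (pcomp_fl_fv (inl e)) (pcomp_fv_fl (inr e)).
- by rewrite (pcomp_fl_fv (inr e)) (pcomp_fv_fl (inl e)).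
- by rewrite (pcomp_fv_fl (inr e)) (pcomp_fl_fv (inl e)).
- by rewrite !pcomp_fl_inr.
- have hef : same_block e f by apply/asboolP; exists X.
  have hfe : same_block f e by rewrite same_blockC.
  by rewrite (pcomp_fl_block hef ef) (pcomp_fl_block hfe (nesym ef)) swap_pair0.
rewrite fsbig_finite //=.
under eq_bigr => e _ do
  rewrite swap_pair_star swap_pair_mul (pcomp_inverse (fl_inverse (inl e))).
rewrite swap_sum; suff h : \sum_(e <- fset_set X)
    precomp K (restr (fun m => fl (inl e) m : bool)) = precomp K (fv v).
  by rewrite /swap_pair; congr pair.
apply: linEnd_ext => x0 m; rewrite linEnd_sum /=.
rewrite /precomp_fun /fv /restr /fl.
case: (boolP (xi m && _)) => [/andP[hm /eqP hv]|hn]; last first.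
  apply: big1_seq => e /=; rewrite in_fset_set // inE => Xe.
  by rewrite (Cat_src hX Xe); case: (xi m) hn => //= /negPf ->.
(* At a point of the tree exactly one edge of X acts, so one term of the sum survives. *)
rewrite -hv in hX; have [e Xe he] := cfg_ex cxi hm hX fX.
rewrite (bigD1_seq e) ?fset_uniq ?in_fset_set ?inE //=.
rewrite hm he (Cat_src hX Xe) eqxx /= big1_seq ?addr0 // => f.
move=> /andP[fe]; rewrite in_fset_set // inE => Xf.
rewrite (Cat_src hX Xf) eqxx /=; case: ifP => //; case: ifP => // hf _.
case/eqP: fe; apply: (cfg_uniq cxi hm) _ _ hf he.
  by rewrite (Cat_src hX Xf).
by apply/asboolP; exists X => //; apply: Cat_Csep hX.
Qed.

Lemma cfg_hom : exists2 psi : LPAab cj E -> S,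
  is_star_hom psi & forall z : lpa_gen E, psi (lpaab cj z) = cfg_gen z.
Proof.
have [f hf fE] := lpa_universal cfg_gen_rel; have [fD fZ fM fS] := hf.
have fN (a : LPA cj E) : f (- a) = - f a by rewrite -scaleN1r fZ scaleN1r.
have pinj (a : LPA cj E) : lpa_sgrp a -> is_pinj (f a).
  elim=> {a} [[v|e]|a b _ IHa _ IHb|a _ IHa].
  - by rewrite fE; exists (fv v), (fv v); split=> //; apply: fv_inverse.
  - rewrite fE; exists (fl (inl e)), (fl (inr e)); split=> //.
    exact: (fl_inverse (inl e)).
  - by rewrite fM; apply: pinj_mul.
  - by rewrite fS; apply: pinj_star.
have [c [a [b [/pinj ha /pinj hb ->]]]|psi hpsi psiE] :=
  quot_lift (@tame_comm_star K cj E) hf.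
  by rewrite fD fN !fM !fS pinj_comm // subrr.
by exists psi => // x; rewrite psiE fE.
Qed.

Variables (psi : LPAab cj E -> S) (psi_hom : is_star_hom psi).
Hypothesis psiE : forall z : lpa_gen E, psi (lpaab cj z) = cfg_gen z.

Let psiM : {morph psi : a b / a ** b}. Proof. by case: psi_hom. Qed.
Let psiS : {morph psi : a / a^!}. Proof. by case: psi_hom. Qed.

Lemma psi_L y : psi (letter_elt cj y) = swap (fl y) (fl (linv y)).
Proof. by case: y => e; rewrite /= ?psiS psiE. Qed.

Definition frun v w : seq (letter E) -> option (seq (letter E)) :=
  foldl (fun k y => pcomp k (fl y)) (fv v) w.

Lemma psi_pe v w :
  exists2 g, partial_inverse (frun v w) g & psi (pe cj v w) = swap (frun v w) g.
Proof.
elim/last_ind: w => [|w y [g hg IH]].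
  by exists (fv v); [apply: fv_inverse | rewrite psiE].
exists (pcomp (fl (linv y)) g); last first.
  by rewrite pe_rcons psiM IH psi_L swap_pair_mul /frun foldl_rcons.
rewrite /frun foldl_rcons -/(frun v w) /pcomp => m m'; split.
  case fE : (frun v w m) => [k|] //= /fl_inverse -> /=; exact/hg.
case gE : (fl (linv y) m') => [k|] //= /hg -> /=; exact/fl_inverse.
Qed.

Lemma rrngE m : rrng m = wrng v0 (rev m).
Proof. by case: m => // y m; rewrite rev_cons wrng_rcons. Qed.

(** From the trivial path a word of F_C runs without cancellation, and its prefixes lie in the tree
    by [cfg_tail]. *)
Lemma frun_nil v w : FCw v w ->
  frun v w [::] = if (v == v0) && xi (rev w) then Some (rev w) else None.
Proof.
elim/last_ind: w => [|w y IH] hw; first by rewrite /= /fv /restr /= eq_sym andbC.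
have [hw' ry ay] := FCw_rcons hw.
rewrite /frun foldl_rcons -/(frun v w) /pcomp IH //.
case: eqP => //= vv0; rewrite rev_rcons.
case hx: (xi (rev w)) => /=; last by case: ifP => // /(cfg_tail cxi); rewrite hx.
have hact : act y (rev w) = y :: rev w.
  case/lastP: w ay {hw hw' ry hx IH} => // w x /(_ _ _ erefl) /admissible_red.
  by rewrite rev_rcons /= => /negPf ->.
by rewrite /fl hx hact rrngE revK -vv0 ry eqxx.
Qed.

Lemma psi_pe_nil v w (x0 : seq (letter E) -> K^o) : FCw v w ->
  (psi (pe cj v w)).1 x0 [::] = if (v == v0) && xi (rev w) then x0 (rev w) else 0.
Proof.
move=> hw; have [g _ ->] := psi_pe v w.
by rewrite /= /precomp_fun frun_nil //; case: ifP.
Qed.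

Lemma psi_qe_nil v w (x0 : seq (letter E) -> K^o) : FCw v w ->
  (psi (qe cj v w)).1 x0 [::] = if (v == v0) && xi (rev w) then x0 [::] else 0.
Proof.
move=> hw; have [g hg e] := psi_pe v w.
rewrite qeE psiM psiS e swap_pair_star swap_pair_mul pcomp_inverse //=.
by rewrite /precomp_fun /restr frun_nil //; case: (_ && _).
Qed.

Lemma psi_Qp_pe_nil v w P (x0 : seq (letter E) -> K^o) :
  FCw v w -> {in P, forall u, FCw v u} ->
  (psi (Qp cj v P ** pe cj v w)).1 x0 [::] =
    if [&& v == v0, all (fun u => xi (rev u)) P & xi (rev w)] then x0 (rev w) else 0.
Proof.
move=> hw; elim: P => [|u P IH] hP.
  rewrite -[Qp cj v [::]]/(lpaab cj (inl v)) mul_V_pe psi_pe_nil //.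
have hP' : {in P, forall u', FCw v u'} by move=> u' h; apply: hP; rewrite inE h orbT.
rewrite Qp_cons -sa_mulA psiM; have {}IH := IH hP'.
rewrite -[LHS]/((psi (qe cj v u)).1 ((psi (Qp cj v P ** pe cj v w)).1 x0) [::]).
rewrite psi_qe_nil ?IH /=; last by apply: hP; rewrite inE eqxx.
by case: (v == v0); case: (xi (rev u)).
Qed.

End Configurations.

(** * Completion of a finite tree by the choice function *)

Section Completion.
Variables (E : sepGraph) (ch : Cfin E -> edge E) (hch : is_choice ch).
Variables (v0 : vert E) (T : {fset gpath E}).
Hypothesis hT : Xtrees v0 T.
Implicit Types (e f : edge E) (x y : letter E) (m w : seq (letter E)).

(** Inverse edges are always allowed, as [cfg_inr] demands. An infinite block left undecided by T
    receives no edge. *)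
Definition tstep m y : Prop :=
  (v0, rev (y :: m)) \in T \/
  match y with
  | inr _ => True
  | inl e => exists2 X : Cfin E, ch X = e &
      forall f, (val X : set (edge E)) f -> (v0, rev (inl f :: m)) \notin T
  end.

Fixpoint tsteps m : Prop := if m is y :: m' then tsteps m' /\ tstep m' y else True.

(* T completed to an infinite tree: a block not decided by T is decided by ch. *)
Definition completion : pred (seq (letter E)) :=
  fun m => `[< FCw v0 (rev m) /\ tsteps m >].

Let T_FCw w : (v0, w) \in T -> FCw v0 w.
Proof. by case: hT => _ h _ _ /h[/FCP]. Qed.

Let T_rcons w y : (v0, rcons w y) \in T -> (v0, w) \in T.
Proof.
case: hT => _ _ lo _ h; apply: lo h _; apply/pprefixP.
by exists [:: y]; rewrite cats1.
Qed.

Lemma CfinP (X : Cfin E) : Csep (val X) /\ finite_set (val X).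
Proof. by have := valP X; rewrite inE. Qed.

Lemma ch_inj (X X' : Cfin E) : (val X' : set (edge E)) (ch X) -> X = X'.
Proof.
by move=> h; apply: val_inj; apply: (Csep_inj (CfinP X).1 (CfinP X').1 (hch X) h).
Qed.

(** Two extensions in T agree by compatibility, a chosen edge is allowed only where T has no
    extension from its block, and a block has one chosen edge. *)
Lemma push_inl e f m : same_block e f -> tstep m (inl e) -> tstep m (inl f) -> e = f.
Proof.
move=> ef [eT|[X eX hX]] [fT|[X' fX hX']].
- case: hT => _ _ _ /(_ _ _ eT fT) /compatibleP - /(_ (T_FCw eT) (T_FCw fT)).
  rewrite !rev_cons -!cats1 compw_cat /=.
  by case: eqP => [[]|_] //; rewrite ef.
- have Xe : (val X' : set (edge E)) e.
    apply: (@same_blockE _ _ _ e (CfinP X').1 (hch X')).1.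
    by rewrite fX same_blockC.
  by have := hX' _ Xe; rewrite eT.
- have Xf : (val X : set (edge E)) f.
    by apply: (@same_blockE _ _ _ f (CfinP X).1 (hch X)).1; rewrite eX.
  by have := hX _ Xf; rewrite fT.
- rewrite -eX -fX; congr ch; apply: ch_inj.
  apply: (@same_blockE _ _ _ _ (CfinP X').1 (hch X')).1.
  by rewrite fX eX same_blockC.
Qed.

Lemma completion_cons y m :
  FCw v0 (rev (y :: m)) -> completion m -> tstep m y -> completion (y :: m).
Proof. by move=> h1 /asboolP[h2 h3] h4; apply/asboolP. Qed.

Lemma completion_tail y m : completion (y :: m) -> completion m.
Proof.
by move=> /asboolP[]; rewrite rev_cons => /FCw_rcons[h _ _] [/= ht _]; apply/asboolP.
Qed.

Lemma completionP : configuration v0 completion.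
Proof.
split.
- exact/asboolP.
- exact: completion_tail.
- by move=> y m /asboolP[]; rewrite rev_cons => /FCw_rcons[_ h _] _; rewrite rrngE.
- move=> x y m /asboolP[]; rewrite !rev_cons => /FCw_rcons[_ _ /(_ _ _ erefl) h] _.
  exact: admissible_red.
- move=> e m hm rm.
  have push : act (inr e) m = inr e :: m -> completion (act (inr e) m).
    move=> am; rewrite am; apply: completion_cons => //; last by right.
    rewrite rev_cons; apply: FCw_rconsI; first by case/asboolP: hm.
      by rewrite -rrngE.
    move=> x w mw; have mE : m = x :: rev w by rewrite -[m]revK mw rev_rcons.
    move: rm am; rewrite mE /= /admissible => ->; rewrite eqxx /=.
    case: x {mw mE} => // f; case: (eqVneq f e) => // ->.
    by rewrite eqxx => /(congr1 size)/= /eqP; rewrite -[X in X == _]addn0 -addn2 eqn_add2l.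
  case: m hm rm push => [|z m] hm rm push; first exact: push.
  move: push; rewrite /=; case: eqP => [_ _|_]; last exact.
  exact: completion_tail hm.
- move=> e f m hm rm ef he hf.
  have pop a g m' : completion (inr a :: m') -> same_block a g ->
      completion (act (inl g) (inr a :: m')) -> a = g.
    move=> _ ag /=; case: eqP => [[] //|_] /asboolP[]; rewrite !rev_cons.
    by move=> /FCw_rcons[_ _ /(_ _ _ erefl)]; rewrite /admissible ag andbF.
  have push g : act (inl g) m = inl g :: m -> completion (act (inl g) m) -> tstep m (inl g).
    by move=> -> /asboolP[_ []].
  (* After a^-1 with a in the block, only popping is possible: pushing another edge of the block
     would not be C-separated. *)
  have [[a [m' [mE ae]]]|hn] := pselect (exists a m', m = inr a :: m' /\ same_block a e).
    have af : same_block a f.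
      have [X hX Xa] := Csep_cover a; apply/(@same_blockE _ _ _ f hX Xa).
      have Xe := (@same_blockE _ _ _ e hX Xa).1 ae.
      exact: (@same_blockE _ _ _ f hX Xe).1 ef.
    by rewrite mE in hm he hf; rewrite -(pop _ _ _ hm ae he) -(pop _ _ _ hm af hf).
  have pE g : same_block g e -> act (inl g) m = inl g :: m.
    move=> ge; case: (m) hn => //= z m' hn; case: eqP => // zg; case: hn.
    by exists g, m'; split => //; rewrite -[z]linvK -zg.
  apply: (push_inl (m := m)) => //; apply: push => //; apply: pE.
    exact: same_blockxx.
  by rewrite same_blockC.
- move=> X m hm hX fX.
  (* After a^-1 with a in X the required edge is a, which pops. Otherwise T supplies the edge if it
     extends m within X, and [ch] does if not. *)
  have [[a [m' [mE Xa]]]|hn] := pselect (exists a m', m = inr a :: m' /\ X a).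
    exists a => //; rewrite mE /= eqxx; move: hm; rewrite mE; exact: completion_tail.
  have pE g : X g -> act (inl g) m = inl g :: m.
    move=> Xg; case: (m) hn => //= z m' hn; case: eqP => // zg; case: hn.
    by exists g, m'; split => //; rewrite -[z]linvK -zg.
  have hX' := Cat_Csep hX.
  have Fg g : X g -> FCw v0 (rev (inl g :: m)).
    move=> Xg; rewrite rev_cons; apply: FCw_rconsI; first by case/asboolP: hm.
      by rewrite -rrngE (esym (Cat_src hX Xg)).
    move=> x w mw; have mE : m = x :: rev w by rewrite -[m]revK mw rev_rcons.
    rewrite /admissible; have -> : lrng x == lsrc (inl g).
      by rewrite /= (Cat_src hX Xg) mE.
    case: x {mw} mE => //= a mE; apply/negP => ag; apply: hn; exists a, (rev w).
    split=> //; apply/(@same_blockE _ _ _ a hX' Xg); by rewrite same_blockC.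
  have [[g Xg gT]|hn'] := pselect (exists2 g, X g & (v0, rev (inl g :: m)) \in T).
    by exists g; rewrite // pE //; apply: completion_cons; [apply: Fg|by []|left].
  have XF : X \in Cfin E by rewrite inE.
  pose X0 : Cfin E := SigSub XF.
  have Xc : X (ch X0) by apply: (hch X0).
  exists (ch X0) => //; rewrite pE //; apply: completion_cons => //; first exact: Fg.
  by right; exists X0 => // f Xf; apply/negP => fT; apply: hn'; exists f.
Qed.

Lemma completion_sub w : (v0, w) \in T -> completion (rev w).
Proof.
elim/last_ind: w => [|w y IH] hw; first exact: cfg_nil completionP.
rewrite rev_rcons; apply: completion_cons; first by rewrite rev_cons revK; apply: T_FCw.
  by apply: IH; apply: T_rcons hw.
by left; rewrite rev_cons revK.
Qed.

(** Beyond [Lword w] only inverse edges, which are always allowed, and edges with singleton blocks,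
    which are forced choices, occur. *)
Lemma completion_Lword w : FCw v0 w -> (v0, Lword w) \in T -> completion (rev w).
Proof.
have [t {1 3}-> ht] := Lword_prefix v0 w => hw wT.
elim/last_ind: t ht hw => [|t y IH] ht; first by rewrite cats0 => _; apply: completion_sub.
rewrite -rcons_cat => hw; rewrite rev_rcons; apply: completion_cons.
- by rewrite rev_cons revK.
- apply: IH; last by have [] := FCw_rcons hw.
  by move=> z zt; apply: ht; rewrite mem_rcons inE zt orbT.
have : negligible y by apply: ht; rewrite mem_rcons inE eqxx.
case: y {ht hw} => [e|e] //= he; last by right.
have [eT|/negP eT] := boolP ((v0, rev (inl e :: rev (Lword w ++ t))) \in T); first by left.
right; have XF : [set e] \in Cfin E by rewrite inE; split=> //; apply: finite_set1.
exists (SigSub XF); first exact: (hch (SigSub XF)).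
by move=> f /= ->; apply/negP.
Qed.

(** A nontrivial maximal element of T' other than h ends neither in an inverse edge nor in a chosen
    edge, so its last step in the completion comes from T. The maximal elements of T' generate
    it. *)
Lemma completion_Ereduced T' h : XLtrees v0 T' -> tree_Ereduced ch T' h -> h \in T ->
  (forall w, (v0, w) \in T' -> completion (rev w)) -> {subset T' <= T}.
Proof.
move=> [[_ hF _ _] hL] hred hh hc.
have [T0 hTF lT _] := hT.
apply: maxT_lower => // g gM; have [gT _] := (in_maxT T' g).1 gM.
have [_ gv] := hF _ gT.
have [->//|/eqP gh] := eqVneq g h.
have [_ gc] := hred _ gM gh.
have gE : g = (v0, g.2) by rewrite -gv /psrc -surjective_pairing.
case/lastP eg : g.2 => [|w y].
  have /fset0Pn[k kT] := T0; apply: (lT _ _ kT); rewrite gE eg /pprefix /=.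
  by have [_ <-] := hTF _ kT; rewrite eqxx prefix0s.
rewrite gE eg; have := hc g.2; rewrite -gE eg => /(_ gT); rewrite rev_rcons.
move=> /asboolP[_ [_ [|]]]; first by rewrite rev_cons revK.
have yn := hL _ y gM (ex_intro _ w eg).
case: y eg yn => [e|e] eg yn; last by case: yn.
by move=> [X eX _]; case: (gc X); exists w; rewrite eX.
Qed.

End Completion.

(** * Triangularity of the coefficient matrix *)

Theorem theorem4p6 (E : sepGraph) (K : comPzRingType) (cj : {rmorphism K -> K})
    (cjK : involutive cj) (ch : Cfin E -> edge E) (hch : is_choice ch) :
  is_basis (M := LPAab cj E) (Bbar_index ch) (@cross_elt K cj E).
Proof.
split=> [x|s c us Js sum0].
  by have [s [c [_ Js xE]]] := LPAab_spanned hch x; exists s, c.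
suff : forall n i, i \in s -> (#|` i.1| < n)%N -> c i = 0.
  by move=> h i si; apply: h si (ltnSn _).
elim=> // n IH [T g] si; rewrite ltnS => /= Tn.
have [Fg [TL gT] red] := Js _ si; rewrite /= in Fg TL gT red.
set xi := completion ch g.1 T.
have cxi : configuration g.1 xi := completionP hch TL.1.
have [psi hpsi psiE] := cfg_hom cxi cjK.
have [psiD psiZ psiM psiS] := hpsi.
have psi0 : psi 0 = 0 by rewrite -[0 in LHS](scale0r 0) psiZ scale0r.
(* The indicator of the path g; words of a configuration are stored reversed. *)
pose d : seq (letter E) -> K^o := fun m => (m == rev g.2)%:R.
have val0 : \sum_(i <- s) c i * (psi (cross_elt cj i)).1 d [::] = 0.
  have := congr1 (fun a => (psi a).1 d [::]) sum0; rewrite psi0 => h.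
  apply: etrans h.
  rewrite (big_morph (fun a => (psi a).1 d [::] : K) (op1 := +%R) (id1 := 0)).
  - by apply: eq_bigr => i _; rewrite psiZ.
  - by move=> a b; rewrite psiD.
  - by rewrite psi0.
have val T' g' : (T', g') \in s -> (psi (cross_elt cj (T', g'))).1 d [::] =
    if [&& g'.1 == g.1, all (fun u => xi (rev u)) (words T') & xi (rev g'.2)]
    then (g'.2 == g.2)%:R else 0.
  move=> /Js[/= Fg' [XT' _] _]; have Fw := (FCP' g').1 Fg'.
  have [_ hF _ _] := XT'.1.
  rewrite /cross_elt /= (tree_eltE cj XT'.1).
  have -> : path_elt cj g' = pe cj g'.1 g'.2.
    by case: (g') Fw => v w /andP[/path_elt_pe ->].
  rewrite (psi_Qp_pe_nil cxi hpsi psiE) //.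
    by rewrite /d (can_eq revK).
  by move=> u /wordsP[h /hF[/FCP' Fh hv] ->]; rewrite -hv.
have [_ hF _ _] := TL.1.
have Fw := (FCP' g).1 Fg.
have xg : xi (rev g.2).
  exact: (completion_Lword hch TL.1).
move: val0; rewrite (bigD1_seq (T, g)) //= (val _ _ si) eqxx xg andbT /=.
have -> : all (fun u => xi (rev u)) (words T).
  apply/allP => u /wordsP[h hT ->]; apply: (completion_sub hch TL.1).
  by have [_ <-] := hF _ hT; rewrite /psrc -surjective_pairing.
rewrite eqxx mulr1 big1_seq ?addr0 // => -[T' g'] /andP[ne si'].
rewrite (val _ _ si'); case: ifP => [/and3P[/eqP g1 /allP xT' _]|]; last by rewrite mulr0.
case: eqP => [g2|]; last by rewrite mulr0.
have gg : g' = g by rewrite (surjective_pairing g') g1 g2 -surjective_pairing.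
rewrite {}gg {g1 g2} in ne si' *; rewrite (IH (T', g)) ?mul0r //=.
(* T' lies in the completion of T, hence in T, and differs from T; so the induction hypothesis
   applies. *)
apply: leq_trans Tn; apply: fproper_ltn_card; rewrite fproperEneq.
apply/andP; split; first by apply: contraNneq ne => ->.
have [/= _ [TL' _] red'] := Js _ si'.
apply/fsubsetP; apply: (completion_Ereduced TL.1 TL' red' gT).
by move=> w wT'; apply: xT'; apply/wordsP; exists (g.1, w).
Qed.
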